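(* Let $G$ be a nontrivial compactly generated totally disconnected locally compact group. Suppose the following: $G$ is one-ended; $\mathrm{QZ}(G)=\{1\}$; $G$ has no nontrivial compact normal subgroups; $G$ is locally of finite quotient type; no open subgroup of $G$ has an infinite discrete quotient; and the centraliser (in $G$) of every nontrivial closed locally normal subgroup of $G$ is compact. Then $G$ is locally indecomposable.
   Context: $\mathrm{QZ}(G)$ is the subgroup of elements of $G$ with open centraliser. A subgroup of $G$ is locally normal if it has open normaliser. $G$ is locally of finite quotient type if for every compact open subgroup $U$ of $G$ and every natural number $n$, $U$ has only finitely many open normal subgroups of index $n$. A discrete quotient of an open subgroup $O$ is a quotient $O/N$ by an open normal subgroup $N$ of $O$. A local direct factor of $G$ is a closed subgroup $H$ such that some open subgroup of $G$ splits, as a topological group, as a direct product $H \times L$. $G$ is locally indecomposable if every local direct factor of $G$ is discrete or open. $G$ is one-ended if some (equivalently any) Cayley--Abels graph of $G$ has exactly one end, where a Cayley--Abels graph is a connected locally finite simple graph with a vertex-transitive action of $G$ by automorphisms with compact open vertex stabilisers. *)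

(* Defs.v *)
From HB Require Import structures.
From mathcomp Require Import all_boot.
From mathcomp Require Import all_classical topology.

Set Implicit Arguments.
Unset Strict Implicit.
Unset Printing Implicit Defensive.

Local Open Scope classical_set_scope.
Local Open Scope card_scope.
Local Open Scope group_scope.

HB.mixin Record isTopologicalGroup G & Topological G & Group G := {
  mulg_continuous : continuous (fun x : G * G => x.1 * x.2);
  invg_continuous : continuous (fun x : G => x^-1)
}.

#[short(type="topologicalGroupType")]
HB.structure Definition TopologicalGroup :=
  {G of Topological G & Group G & isTopologicalGroup G}.

Section Subgroups.
Variable G : groupType.
Implicit Types (H N O K : set G).

Definition subgroup H := group_closed (mem H).

Lemma subgroupP H :
  subgroup H <-> H 1 /\ (forall x y, H x -> H y -> H (x / y)).
Proof.
split=> -[H1 HB]; split.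
- exact: set_mem H1.
- by move=> x y Hx Hy; apply: set_mem; apply: HB; exact: mem_set.
- exact: mem_set.
- by move=> x y Hx Hy; apply: mem_set; apply: HB; exact: set_mem.
Qed.

Definition generated K : set G := smallest subgroup K.

Definition normal_subgroup O N :=
  [/\ subgroup N, N `<=` O & forall x n, O x -> N n -> N (n ^ x)].

Definition normaliser H : set G := [set g | [set h ^ g | h in H] = H].

Definition centraliser H : set G := [set g | forall h, H h -> commute g h].

Definition cosets O N : set (set G) := [set [set x * n | n in N] | x in O].

End Subgroups.

Section TopologicalGroups.
Variable G : topologicalGroupType.
Implicit Types (H L N O U : set G).

(* Local compactness is understood to include the Hausdorff axiom, which
   anyway follows from total disconnectedness for a topological group. *)
Definition tdlc := [/\ hausdorff_space G, locally_compact [set: G]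
  & totally_disconnected [set: G]].

Definition compactly_generated :=
  exists2 K : set G, compact K & generated K = setT.

Definition quasicentre : set G := [set g | open (centraliser [set g])].

Definition locally_normal H := subgroup H /\ open (normaliser H).

Definition locally_finite_quotient_type :=
  forall U, subgroup U -> open U -> compact U -> forall n : nat,
    finite_set [set N | [/\ normal_subgroup U N, open N & cosets U N #= `I_n]].

Definition has_infinite_discrete_quotient O :=
  exists N, [/\ normal_subgroup O N, open N & infinite_set (cosets O N)].

Definition discrete_set H := forall x, H x -> isolated H x.

Definition homeomorphism_on (X Y : topologicalType) (A : set X) (B : set Y)
    (f : X -> Y) :=
  [/\ set_bij A B f, {within A, continuous f}
    & exists2 g : Y -> X, {in A, cancel f g} & {within B, continuous g}].

(* O is the internal direct product of H and L, with the product topology. *)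
Definition splits_as O H L :=
  [/\ subgroup H, subgroup L, (forall h l, H h -> L l -> commute h l)
    & homeomorphism_on (H `*` L) O (fun x => x.1 * x.2)].

Definition local_direct_factor H :=
  [/\ subgroup H, closed H
    & exists O L, [/\ subgroup O, open O & splits_as O H L]].

Definition locally_indecomposable :=
  forall H, local_direct_factor H -> discrete_set H \/ open H.

End TopologicalGroups.
Arguments quasicentre G : clear implicits.

Record simple_graph := SimpleGraph {
  vertex :> Type;
  adj : rel vertex;
  adj_sym : symmetric adj;
  adj_irr : irreflexive adj
}.

Section Graphs.
Variable V : simple_graph.
Implicit Types (S : set V) (x y : V).

Definition joined_in S x y := exists p : seq V,
  [/\ path (@adj V) x p, last x p = y & all [in S] (x :: p)].

Definition connected_graph :=
  (exists x : V, True) /\ forall x y, joined_in setT x y.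

Definition locally_finite := forall x, finite_set [set y | adj x y].

Definition ray : set (nat -> V) :=
  [set r | injective r /\ forall n, adj (r n) (r n.+1)].

(* Two rays are equivalent when, for every finite set S of vertices, they have
   tails in the same connected component of the graph with S deleted. *)
Definition ray_equiv (r r' : nat -> V) :=
  forall S, finite_set S -> exists n : nat, forall i j : nat,
    (n <= i)%N -> (n <= j)%N -> joined_in (~` S) (r i) (r' j).

Definition ends : set (set (nat -> V)) :=
  [set [set r' | ray r' /\ ray_equiv r r'] | r in ray].

End Graphs.
Arguments ends V : clear implicits.

Record cayley_abels (G : topologicalGroupType) (V : simple_graph)
    (a : G -> V -> V) : Prop := CayleyAbels {
  ca_connected : connected_graph V;
  ca_locally_finite : locally_finite V;
  ca_act1 : forall x, a 1 x = x;
  ca_actM : forall g h x, a (g * h) x = a g (a h x);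
  ca_adj : forall g x y, adj (a g x) (a g y) = adj x y;
  ca_transitive : forall x y, exists g, a g x = y;
  ca_stabiliser : forall x,
    open [set g | a g x = x] /\ compact [set g | a g x = x]
}.

Definition one_ended (G : topologicalGroupType) :=
  exists (V : simple_graph) (a : G -> V -> V),
    cayley_abels a /\ ends V #= `I_1.

(* Main.v *)
Require Import Defs.
From HB Require Import structures.
From mathcomp Require Import all_boot.
From mathcomp Require Import ssralg ssrnum rat.
From mathcomp Require Import all_classical topology.

(* Let O = H x L be an open subgroup with H and L nontrivial, and put A = C(L),
   V = A C(A).  As QZ(G) = 1, A is the double centraliser of H; as centralisers of
   nontrivial closed locally normal subgroups are compact, V is a compact open subgroup.
   Write E(N) for the set of g with N contained in gVg^-1, where N runs over the
   nontrivial factors N = C(C(N)) with N C(N) open and C(N) nontrivial.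

   - G is unimodular and open compact subgroups have compact normalisers, since no open
     subgroup has an infinite discrete quotient.  With finite quotient type it follows that
     the g with |gVg^-1 : gVg^-1 n W| <= n form a relatively compact set.  In particular
     P <= gAg^-1 and Q <= gC(A)g^-1 hold together only for g in a compact set.
   - A compact open subgroup has finitely many direct factors, because nontrivial compact
     subgroups have proper subgroups of bounded index.  Together with the previous point,
     E(N) is almost invariant under right translation, so by one-endedness E(N) or its
     complement is relatively compact.
   - If the complement of E(N) were relatively compact, then a nontrivial open subgroup of N
     would be contained in every conjugate of V, whose intersection is trivial.
   - If every E(N) is relatively compact, take indecomposable factors N with E(N) containing
     larger and larger balls, and translate them so that the identity lies at the boundary of
     the ball.  Their elements outside tVt^-1, for t in a compact generating set, accumulate at some j <> 1.  Every
     factor B is cut by some gAg^-1 with g in E(N) for all large N of the sequence, so j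
     centralises a factor inside B.  Hence j normalises every factor, in particular all
     gAg^-1, and thus lies in a compact normal subgroup: a contradiction. *)

Set Implicit Arguments.
Unset Strict Implicit.
Unset Printing Implicit Defensive.

Local Open Scope classical_set_scope.
Local Open Scope card_scope.
Local Open Scope group_scope.

Local Notation "''C' A" := (centraliser A) (at level 8, A at level 8).

(** * Subgroups, conjugates and coset covers *)

Section Groups.
Variable G : groupType.
Implicit Types (A B H N O P R U V W : set G) (g x y : G).

Lemma sub1 H : subgroup H -> H 1.
Proof. by move=> /subgroupP[]. Qed.

Lemma subV H x : subgroup H -> H x -> H x^-1.
Proof. by move=> /subgroupP[H1 HB] Hx; rewrite -div1g; exact: HB. Qed.

Lemma subM H x y : subgroup H -> H x -> H y -> H (x * y).
Proof.
move=> sH Hx Hy; have [_ HB] := (subgroupP H).1 sH.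
by rewrite -[y]invgK; apply: HB => //; exact: subV.
Qed.

Lemma subVM H x y : subgroup H -> H x -> H y -> H (x^-1 * y).
Proof. by move=> sH Hx Hy; apply: subM => //; exact: subV. Qed.

Lemma sub_conj H x y : subgroup H -> H x -> H y -> H (x ^ y).
Proof. by move=> sH Hx Hy; apply: subM => //; [exact: subV | exact: subM]. Qed.

Lemma mksub H : H 1 -> (forall x y, H x -> H y -> H (x^-1 * y)) -> subgroup H.
Proof.
move=> H1 HB; have HV x : H x -> H x^-1 by move=> /HB /(_ H1); rewrite mulg1.
apply/subgroupP; split=> // x y Hx Hy.
by rewrite -[x]invgK; apply: HB; exact: HV.
Qed.

Lemma subT : subgroup [set: G].
Proof. exact: mksub. Qed.

Lemma subI H N : subgroup H -> subgroup N -> subgroup (H `&` N).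
Proof.
move=> sH sN; apply: mksub; first by split; exact: sub1.
by move=> x y [? ?] [? ?]; split; exact: subVM.
Qed.

Lemma sub_centr A : subgroup ('C A).
Proof.
apply: mksub => [h _|x y Cx Cy h Ah]; first exact/commute_sym/commute1.
apply/commute_sym/commuteM; first by apply/commuteV/commute_sym/Cx.
by apply/commute_sym/Cy.
Qed.

Lemma centrS A B : A `<=` B -> 'C B `<=` 'C A.
Proof. by move=> AB x Cx h /AB; exact: Cx. Qed.

Lemma centr_sym A B : A `<=` 'C B -> B `<=` 'C A.
Proof. by move=> AB x Bx h /AB; move=> /(_ _ Bx) /commute_sym. Qed.

Lemma sub_centr2 A : A `<=` 'C ('C A).
Proof. exact: centr_sym. Qed.

Lemma centr3 A : 'C ('C ('C A)) = 'C A.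
Proof.
by apply/seteqP; split; [apply: centrS; exact: sub_centr2 | exact: sub_centr2].
Qed.

(* As x ^ g is g^-1 * x * g, this is the conjugate gHg^-1. *)
Definition cj g H : set G := [set x | H (x ^ g)].

Lemma cj1 H : cj 1 H = H.
Proof. by apply/seteqP; split=> x; rewrite /cj /= conjg1. Qed.

Lemma cjM g h H : cj (g * h) H = cj g (cj h H).
Proof. by apply/seteqP; split=> x; rewrite /cj /= conjgM. Qed.

Lemma cjK g H : cj g (cj g^-1 H) = H.
Proof. by rewrite -cjM mulgV cj1. Qed.

Lemma cjVK g H : cj g^-1 (cj g H) = H.
Proof. by rewrite -cjM mulVg cj1. Qed.

Lemma cjS g H N : (cj g H `<=` cj g N) <-> (H `<=` N).
Proof.
split=> HN x; last exact: HN.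
by move=> Hx; have := HN (x ^ g^-1); rewrite /cj /= conjgKV; exact.
Qed.

Lemma cjSl g H N : (cj g H `<=` N) <-> (H `<=` cj g^-1 N).
Proof. by rewrite -(cjS g H) cjK. Qed.

Lemma cjI g H N : cj g (H `&` N) = cj g H `&` cj g N.
Proof. by []. Qed.

Lemma cj_inj g : injective (cj g).
Proof. by move=> H N HN; rewrite -(cjVK g H) HN cjVK. Qed.

Lemma sub_cj g H : subgroup H -> subgroup (cj g H).
Proof.
move=> sH; apply: mksub => [|x y]; rewrite /cj /= ?conj1g; first exact: sub1.
by rewrite conjMg conjVg; exact: subVM.
Qed.

Lemma cj_id g H : subgroup H -> H g -> cj g H = H.
Proof.
move=> sH Hg; apply/seteqP; split=> x; rewrite /cj /= => Hx.
  by rewrite -(conjgK g x); apply: sub_conj => //; exact: subV.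
exact: sub_conj.
Qed.

Lemma cj_set1 g : cj g [set 1] = [set 1].
Proof.
apply/seteqP; split=> x; rewrite /cj /=; last by move=> ->; rewrite conj1g.
by move/eqP; rewrite conjg_eq1 => /eqP.
Qed.

Lemma cj_eq1 g H : (cj g H = [set 1]) <-> (H = [set 1]).
Proof. by split=> [|->]; [rewrite -{1}(cj_set1 g) => /cj_inj | exact: cj_set1]. Qed.

Lemma commuteJ x y g : commute (x ^ g) (y ^ g) <-> commute x y.
Proof.
split=> [|xy]; last by rewrite /commute -!conjMg xy.
by rewrite /commute -!conjMg => /conjg_inj.
Qed.

Lemma centr_cj g A : 'C (cj g A) = cj g ('C A).
Proof.
apply/seteqP; split=> x Cx h.
  by move=> Ah; apply/(commuteJ _ _ g^-1); rewrite conjgK; apply: Cx; rewrite /cj /= conjgKV.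
by move=> Ah; apply/(commuteJ _ _ g); exact: Cx.
Qed.

Lemma normaliserE H : normaliser H = [set g | cj g H = H].
Proof.
have imJ g : [set h ^ g | h in H] = cj g^-1 H.
  apply/seteqP; split=> x /=; first by move=> [h Hh <-]; rewrite /cj /= conjgK.
  by move=> Hx; exists (x ^ g^-1) => //; rewrite conjgKV.
apply/seteqP; split=> g; rewrite /normaliser /= imJ => HE.
  by rewrite -{1}HE cjK.
by rewrite -{1}HE cjVK.
Qed.

Lemma sub_normaliser H : subgroup (normaliser H).
Proof.
rewrite normaliserE; apply: mksub => [|x y /= xH yH]; first exact: cj1.
by rewrite cjM yH -{1}xH cjVK.
Qed.

Definition mulset A B : set G := [set x | exists a b, [/\ A a, B b & x = a * b]].

Lemma mulsetI A B a b : A a -> B b -> mulset A B (a * b).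
Proof. by move=> Aa Bb; exists a, b. Qed.

Lemma mulsetl A B : B 1 -> A `<=` mulset A B.
Proof. by move=> B1 a Aa; exists a, 1; rewrite mulg1. Qed.

Lemma mulsetr A B : A 1 -> B `<=` mulset A B.
Proof. by move=> A1 b Bb; exists 1, b; rewrite mul1g. Qed.

Lemma mulsetS A B A' B' : A `<=` A' -> B `<=` B' -> mulset A B `<=` mulset A' B'.
Proof. by move=> AA BB _ [a [b [/AA Aa /BB Bb ->]]]; exact: mulsetI. Qed.

Lemma mulset_sub A B H : subgroup H -> A `<=` H -> B `<=` H -> mulset A B `<=` H.
Proof. by move=> sH AH BH _ [a [b [/AH Ha /BH Hb ->]]]; exact: subM. Qed.

Lemma sub_mulset A B : subgroup A -> subgroup B -> B `<=` 'C A ->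
  subgroup (mulset A B).
Proof.
move=> sA sB BA; apply: mksub.
  by exists 1, 1; rewrite mulg1; split=> //; exact: sub1.
move=> _ _ [a [b [Aa Bb ->]]] [a' [b' [Aa' Bb' ->]]].
exists (a^-1 * a'), (b^-1 * b'); split; [exact: subVM..|].
have /BA/(_ _ (subVM sA Aa Aa')) := subV sB Bb.
by rewrite /commute => bE; rewrite invgM -!mulgA (mulgA a^-1) (mulgA b^-1) bE !mulgA.
Qed.

Lemma mulsetC A B : B `<=` 'C A -> mulset A B = mulset B A.
Proof.
move=> BA; apply/seteqP; split=> _ [a [b [Aa Bb ->]]].
  by exists b, a; split=> //; rewrite (BA b Bb).
by exists b, a; split=> //; rewrite (BA a Aa).
Qed.

Lemma cj_mulset g A B : cj g (mulset A B) = mulset (cj g A) (cj g B).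
Proof.
apply/seteqP; split=> x [a [b [Aa Bb xE]]].
  exists (a ^ g^-1), (b ^ g^-1); split; rewrite ?/cj /= ?conjgKV //.
  by rewrite -conjMg -xE conjgK.
by rewrite xE; exists (a ^ g), (b ^ g); rewrite conjMg.
Qed.

(* For subgroups V and W this says that W n V has index at most n in V. *)
Definition cov n V W := exists s : seq G,
  size s <= n /\ forall x, V x -> exists2 f, f \in s & W (f^-1 * x).

Lemma cov_leq m n V W : m <= n -> cov m V W -> cov n V W.
Proof. by move=> mn [s [sm sP]]; exists s; split=> //; exact: leq_trans mn. Qed.

Lemma covS n V W V' W' : V' `<=` V -> W `<=` W' -> cov n V W -> cov n V' W'.
Proof.
by move=> V'V WW' [s [sn sP]]; exists s; split=> // x /V'V/sP[f fs /WW']; exists f.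
Qed.

Lemma cov_trans m n V W Z : cov m V W -> cov n W Z -> cov (m * n) V Z.
Proof.
move=> [s [sm sP]] [t [tn tP]]; exists [seq f * h | f <- s, h <- t].
split; first by rewrite size_allpairs leq_mul.
move=> x /sP[f fs /tP[h ht Zx]]; exists (f * h); first exact: allpairs_f.
by rewrite invgM -mulgA.
Qed.

Lemma cov_cj g n V W : cov n V W -> cov n (cj g V) (cj g W).
Proof.
move=> [s [sn sP]]; exists [seq f ^ g^-1 | f <- s]; split; rewrite ?size_map //.
move=> x /sP[f fs Wx]; exists (f ^ g^-1); first exact: map_f.
by rewrite /cj /= conjMg conjVg conjgKV.
Qed.

Lemma cov_inv n V W : subgroup W -> cov n V W -> exists s : seq G,
  [/\ size s <= n, (forall f, f \in s -> V f) &
      forall x, V x -> exists2 f, f \in s & W (f^-1 * x)].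
Proof.
move=> sW [s [sn sP]].
pose r f := if pselect (exists x, V x /\ W (f^-1 * x)) is left e
  then projT1 (cid e) else f.
pose t := [seq r f | f <- [seq f <- s | `[< exists x, V x /\ W (f^-1 * x) >]]].
exists t; split.
- by rewrite size_map size_filter (leq_trans (count_size _ _)).
- move=> f /mapP[h]; rewrite mem_filter => /andP[/asboolP e _] ->.
  by rewrite /r; case: pselect => // e'; case: cid => y /= [].
- move=> x Vx; have [f fs Wfx] := sP x Vx.
  have e : exists x, V x /\ W (f^-1 * x) by exists x.
  exists (r f); first by apply: map_f; rewrite mem_filter fs andbT; apply/asboolP.
  rewrite /r; case: pselect => // e'; case: cid => y /= [Vy Wfy].
  by have := subVM sW Wfy Wfx; rewrite invgM invgK -mulgA mulVKg.
Qed.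

Lemma covI n V W V' : subgroup W -> subgroup V' -> V' `<=` V -> cov n V W ->
  cov n V' (V' `&` W).
Proof.
move=> sW sV' V'V cV; have : cov n V' W by apply: covS cV.
move=> /(cov_inv sW)[s [sn sV'f sP]]; exists s; split=> // x V'x.
have [f fs Wx] := sP x V'x; exists f => //; split=> //.
by apply: subVM => //; exact: sV'f.
Qed.

Lemma cov_setI m n V W W' : subgroup V -> subgroup W -> subgroup W' ->
  cov m V W -> cov n V W' -> cov (m * n) V (W `&` W').
Proof.
move=> sV sW sW' cW cW'; apply: (@cov_trans _ _ _ (V `&` W)); first exact: covI cW.
suff: cov n (V `&` W) ((V `&` W) `&` W') by apply: covS => // x [[]].
by apply: covI cW' => //; exact: subI.
Qed.

End Groups.

(** * Topological groups and relatively compact sets *)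

Section CapList.
Variable G : groupType.
Implicit Types (D V : set G) (s : seq G).

Definition cap_cj s D : set G := [set x | forall f, f \in s -> cj f D x].

Lemma cap_cj_cons f s D : cap_cj (f :: s) D = cj f D `&` cap_cj s D.
Proof.
apply/seteqP; split=> x.
  by move=> H; split=> [|h hs]; apply: H; rewrite in_cons ?eqxx ?hs ?orbT.
by move=> [H1 H2] h; rewrite in_cons => /orP[/eqP->|]; [exact: H1 | exact: H2].
Qed.

Lemma cap_cj_nil D : cap_cj [::] D = setT.
Proof. by apply/seteqP; split. Qed.

Lemma sub_cap_cj s D : subgroup D -> subgroup (cap_cj s D).
Proof.
move=> sD; elim: s => [|f s IH]; first by rewrite cap_cj_nil; exact: subT.
by rewrite cap_cj_cons; apply: subI => //; exact: sub_cj.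
Qed.

Lemma cov_cap_cj n s V D : subgroup V -> subgroup D ->
  (forall f, f \in s -> cov n V (cj f D)) -> cov (n ^ size s) V (cap_cj s D).
Proof.
move=> sV sD; elim: s => [|f s IH] H.
  by rewrite cap_cj_nil; exists [:: 1]; split=> // x _; exists 1 => //; exact: mem_head.
rewrite cap_cj_cons /= expnS; apply: cov_setI => //.
- exact: sub_cj.
- exact: sub_cap_cj.
- by apply: H; exact: mem_head.
- by apply: IH => h hs; apply: H; rewrite in_cons hs orbT.
Qed.

(** An element y of V is f times an element of D with f in [s], and D absorbs conjugation by the
    latter. So finitely many conjugates cut out the intersection of all yDy^-1 with y in V. *)
Lemma core_cap n V D : subgroup V -> subgroup D -> cov n V D ->
  exists s, [/\ size s <= n, (forall f, f \in s -> V f)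
    & forall x y, cap_cj s D x -> V y -> D (x ^ y)].
Proof.
move=> sV sD /(cov_inv sD)[s [sn sV' sP]]; exists s; split=> // x y xs Vy.
have [f fs Dfy] := sP y Vy.
by rewrite -(mulVKg f y) conjgM; apply: sub_conj => //; exact: xs.
Qed.

End CapList.

Section Top.
Variable G : topologicalGroupType.
Hypothesis hausG : hausdorff_space G.
Implicit Types (A B D H K N O V W X : set G) (f g x y : G).

Lemma mul_cont (T : topologicalType) (u v : T -> G) :
  continuous u -> continuous v -> continuous (fun t => u t * v t).
Proof.
move=> cu cv t; apply: (@continuous2_cvg T G G G _ _ u v (fun a b => a * b) (u t) (v t)).
- exact: (mulg_continuous (u t, v t)).
- exact: cu.
- exact: cv.
Qed.

Lemma id_cont (T : topologicalType) : continuous (fun x : T => x).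
Proof. by move=> x; exact: cvg_id. Qed.

Lemma cst_cont (T U : topologicalType) (a : U) : continuous (fun x : T => a).
Proof. by move=> x; exact: cvg_cst. Qed.

Lemma mull_cont f : continuous (fun x : G => f * x).
Proof. by apply: mul_cont; [exact: cst_cont | exact: id_cont]. Qed.

Lemma mulr_cont f : continuous (fun x : G => x * f).
Proof. by apply: mul_cont; [exact: id_cont | exact: cst_cont]. Qed.

Lemma conj_cont f : continuous (fun x : G => x ^ f).
Proof. by apply: mul_cont; [exact: cst_cont | exact: mulr_cont]. Qed.

Lemma open_cj g O : open O -> open (cj g O).
Proof. by move=> oO; have /continuousP := @conj_cont g; apply. Qed.

Lemma closed_cj g O : closed O -> closed (cj g O).
Proof. by move=> oO; have /continuous_closedP := @conj_cont g; apply. Qed.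

Lemma open_mull f O : open O -> open [set x | O (f * x)].
Proof. by move=> oO; have /continuousP := @mull_cont f; apply. Qed.

Lemma closed_mull f O : closed O -> closed [set x | O (f * x)].
Proof. by move=> oO; have /continuous_closedP := @mull_cont f; apply. Qed.

Lemma image_compact (f : G -> G) K : continuous f -> compact K -> compact (f @` K).
Proof. by move=> fc; apply: continuous_compact; exact: continuous_subspaceT. Qed.

Lemma compact_cj g K : compact K -> compact (cj g K).
Proof.
move=> cK; suff -> : cj g K = (fun x => x ^ g^-1) @` K.
  by apply: image_compact => //; exact: conj_cont.
apply/seteqP; split=> x; rewrite /cj /=.
  by move=> Kx; exists (x ^ g) => //; rewrite conjgK.
by move=> [y Ky <-]; rewrite conjgKV.
Qed.

Lemma compact_mulset A B : compact A -> compact B -> compact (mulset A B).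
Proof.
move=> cA cB; have cAB := compact_setX cA cB.
suff -> : mulset A B = (fun x : G * G => x.1 * x.2) @` (A `*` B).
  by apply: continuous_compact => //; apply: continuous_subspaceT; exact: mulg_continuous.
apply/seteqP; split=> [_ [a [b [Aa Bb ->]]]|_ [[a b] [/= Aa Bb] <-]].
  by exists (a, b).
exact: mulsetI.
Qed.

Lemma open_sub H O : subgroup H -> open O -> O 1 -> O `<=` H -> open H.
Proof.
move=> sH oO O1 OH; suff -> : H = \bigcup_(h in H) [set x | O (h^-1 * x)].
  by apply: bigcup_open => h _; exact: open_mull.
apply/seteqP; split=> [h Hh|x [h Hh] /OH Hx].
  by exists h => //=; rewrite mulVg.
by rewrite -(mulVKg h x); exact: subM.
Qed.

Lemma open_closed_sub H : subgroup H -> open H -> closed H.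
Proof.
move=> sH oH; rewrite -openC; suff -> : ~` H = \bigcup_(h in ~` H) [set x | H (h^-1 * x)].
  by apply: bigcup_open => h _; exact: open_mull.
apply/seteqP; split=> [h Hh|x [h nHh] /= Hhx Hx].
  by exists h => //=; rewrite mulVg; exact: sub1.
apply: nHh; rewrite -[h]invgK -(mulgK x h^-1).
by apply: subV => //; apply: subM => //; exact: subV.
Qed.

Lemma compact_cov K W : subgroup W -> open W -> compact K -> exists n, cov n K W.
Proof.
move=> sW oW cK.
pose un (s : seq G) : set G := [set x | exists2 f, f \in s & W (f^-1 * x)].
suff [s Ks] : exists s, K `<=` un s by exists (size s), s.
apply: contrapT => /forallNP noS.
(* The complements in K of finite unions of cosets of W form a base of a proper filter; the open
   coset xW of a cluster point x gives the contradiction. *)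
pose F : set_system G := [set X | exists s, K `\` un s `<=` X].
have FF : ProperFilter F.
  split.
    by move=> [s Ks]; apply: (noS s) => x Kx; apply: contrapT => nx; exact: (Ks x).
  split; first by exists [::].
    move=> P Q [s sP] [t tQ]; exists (s ++ t) => x [Kx nx]; split; [apply: sP|apply: tQ];
    by split=> // -[f fs Wf]; apply: nx; exists f => //; rewrite mem_cat fs ?orbT.
  by move=> P Q PQ [s sP]; exists s; exact: subset_trans PQ.
have FK : F K by exists [::] => x [].
have [x [Kx clx]] := cK F FF FK.
have Wx : nbhs x [set y | W (x^-1 * y)].
  apply: open_nbhs_nbhs; split; first exact: open_mull.
  by rewrite /= mulVg; exact: sub1.
have Fx : F (K `\` un [:: x]) by exists [:: x].
have [y [[Ky ny] Wy]] := clx _ _ Fx Wx.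
by apply: ny; exists x => //; exact: mem_head.
Qed.

(** The finitely many cosets fX other than X form a closed set missing 1; the part of O outside it
    is a neighbourhood of 1 contained in X. *)
Lemma open_of_cov n X O : subgroup X -> closed X -> open O -> O 1 -> cov n O X -> open X.
Proof.
move=> sX cX oO O1 [s [_ sP]].
pose t := [seq f <- s | `[< ~ X f^-1 >]].
pose Z : set G := \bigcup_(f in [set` t]) [set x | X (f^-1 * x)].
have cZ : closed Z.
  by apply: closed_bigcup => [|f _]; [exact: finite_seq | exact: closed_mull].
apply: (@open_sub _ (O `&` ~` Z)) => //.
- by apply: openI => //; rewrite openC.
- split=> // -[f /=]; rewrite mem_filter => /andP[/asboolP nX _].
  by rewrite mulg1.
- move=> x [Ox nZx]; have [f fs Xfx] := sP x Ox.
  have [Xf|nXf] := pselect (X f^-1).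
    by rewrite -(mulKg f^-1 x); apply: subM => //; exact: subV.
  by exfalso; apply: nZx; exists f => //=; rewrite mem_filter fs andbT; apply/asboolP.
Qed.

Lemma closed_set1 : closed [set (1 : G)].
Proof. by apply: compact_closed => //; exact: compact_set1. Qed.

Lemma closed_centr A : closed ('C A).
Proof.
suff -> : 'C A = \bigcap_(a in A) [set x | [set (1 : G)] (x^-1 * x ^ a)].
  apply: closed_bigI => a _.
  have : continuous (fun x : G => x^-1 * x ^ a).
    by apply: mul_cont; [exact: invg_continuous | exact: conj_cont].
  by move=> /continuous_closedP; apply; exact: closed_set1.
apply/seteqP; split=> x Cx a Aa.
  by rewrite /= conjgE (Cx a Aa) mulKg mulVg.
have /= := Cx a Aa; rewrite -commgEl => xa.
by rewrite /commute commgC xa mulg1.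
Qed.

Lemma open_cap_cj s D : open D -> open (cap_cj s D).
Proof.
move=> oD; elim: s => [|f s IH]; first by rewrite cap_cj_nil; exact: openT.
by rewrite cap_cj_cons; apply: openI => //; exact: open_cj.
Qed.

Definition bdd X := exists2 K : set G, compact K & X `<=` K.

Lemma bddS X Y : X `<=` Y -> bdd Y -> bdd X.
Proof. by move=> XY [K cK YK]; exists K => //; exact: subset_trans YK. Qed.

Lemma bddU X Y : bdd X -> bdd Y -> bdd (X `|` Y).
Proof.
move=> [K cK XK] [L cL YL]; exists (K `|` L); first exact: compactU.
exact: setUSS.
Qed.

Lemma bdd0 : bdd set0.
Proof. by exists set0 => //; exact: compact0. Qed.

Lemma bdd_bigcup (I : choiceType) (P : set I) (F : I -> set G) : finite_set P ->
  (forall i, P i -> bdd (F i)) -> bdd (\bigcup_(i in P) F i).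
Proof.
move=> /finite_seqP[s ->]; elim: s => [|i s IH] H.
  by rewrite bigcup0 //; exact: bdd0.
apply: (@bddS _ (F i `|` \bigcup_(j in [set` s]) F j)).
  move=> x [j /=]; rewrite in_cons => /orP[/eqP->|js] Fx; [by left|].
  by right; exists j.
apply: bddU; first by apply: H; rewrite /= mem_head.
by apply: IH => j js; apply: H; rewrite /= in_cons; apply/orP; right.
Qed.

Lemma bddM X Y : bdd X -> bdd Y -> bdd (mulset X Y).
Proof.
move=> [K cK XK] [L cL YL]; exists (mulset K L); first exact: compact_mulset.
exact: mulsetS.
Qed.

Lemma bdd_set1 x : bdd [set x].
Proof. by exists [set x] => //; exact: compact_set1. Qed.

Lemma bdd_cov n X V : compact V -> cov n X V -> bdd X.
Proof.
move=> cV [s [_ sP]].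
apply: (@bddS _ (\bigcup_(f in [set` s]) mulset [set f] V)).
  move=> x /sP[f fs Vfx]; exists f => //; rewrite -(mulVKg f x).
  exact: mulsetI.
apply: bdd_bigcup; first exact: finite_seq.
by move=> f _; apply: bddM; [exact: bdd_set1 | exists V].
Qed.

Lemma cov_bdd X V : subgroup V -> open V -> bdd X -> exists n, cov n X V.
Proof.
move=> sV oV [K cK XK]; have [n cn] := compact_cov sV oV cK.
by exists n; apply: covS cn.
Qed.

Lemma bddV X : bdd X -> bdd [set x | X x^-1].
Proof.
move=> [K cK XK]; exists ((fun x : G => x^-1) @` K).
  by apply: image_compact => //; exact: invg_continuous.
by move=> x /XK Kx; exists x^-1 => //; rewrite invgK.
Qed.

Lemma open_compact_sub X V : subgroup X -> open X -> compact V -> X `<=` V -> compact X.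
Proof.
by move=> sX oX cV XV; apply: subclosed_compact cV XV; exact: open_closed_sub.
Qed.

End Top.

(** * Indices and finite quotient type *)

Lemma inj_finite_set T U (A : set T) (f : T -> U) (B : set U) :
  {in A &, injective f} -> (forall x, A x -> B (f x)) -> finite_set B -> finite_set A.
Proof.
move=> fi fAB fB; rewrite -(eq_finite_set (inj_card_eq fi)).
by apply: sub_finite_set fB => _ [x Ax <-]; exact: fAB.
Qed.

Lemma finite_powerset (T : choiceType) (A : set T) : finite_set A ->
  finite_set [set B | B `<=` A].
Proof.
move=> /finite_seqP[s ->].
pose F (h : {ffun 'I_(size s) -> bool}) : set T :=
  [set x | exists i, h i /\ x = tnth (in_tuple s) i].
apply: (@sub_finite_set _ _ (range F)); last exact/finite_image/finite_finset.
move=> B /= Bs; exists [ffun i => `[< B (tnth (in_tuple s) i) >]] => //.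
apply/seteqP; split=> [x [i [+ ->]]|x Bx]; first by rewrite ffunE => /asboolP.
have /(@tnthP _ _ (in_tuple s))[i xE] : x \in in_tuple s := Bs x Bx; exists i; split=> //.
by rewrite ffunE; apply/asboolP; rewrite -xE.
Qed.

Section Cosets.
Variable G : groupType.
Implicit Types (V W R Z : set G).

Lemma coset_eq W x f : subgroup W -> W (f^-1 * x) ->
  [set x * n | n in W] = [set f * n | n in W].
Proof.
move=> sW Wfx; apply/seteqP; split=> _ [n Wn <-].
  by exists (f^-1 * x * n); [exact: subM | rewrite -mulgA mulVKg].
exists ((f^-1 * x)^-1 * n); first exact: subVM.
by rewrite invgM invgK -mulgA mulVKg.
Qed.

Lemma cosets_cov n V W : subgroup W -> cov n V W ->
  exists2 m, m <= n & cosets V W #= `I_m.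
Proof.
move=> sW [s [sn sP]].
have le : cosets V W #<= `I_(size s).
  apply: (@card_le_trans _ _ _
    ((fun i => [set nth 1 s i * n | n in W]) @` `I_(size s))); last exact: card_image_le.
  apply: subset_card_le => _ [x /sP[f fs Wfx] <-].
  exists (index f s); rewrite /= ?index_mem //= nth_index //.
  by rewrite (coset_eq sW Wfx).
have /finite_setP[m cm] : finite_set (cosets V W) by apply/finite_set_leP; exists (size s).
exists m => //; apply: leq_trans sn; rewrite -card_le_II.
by rewrite -(card_le_eql cm).
Qed.

Lemma cov_cosets V W : subgroup W -> finite_set (cosets V W) -> exists n, cov n V W.
Proof.
move=> sW /finite_seqP[s sE]; exists (size s), [seq xget 1 c | c : set G <- s].
split; first by rewrite size_map.
move=> x Vx; pose c := [set x * n | n in W].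
have cs : c \in s by have : cosets V W c; [exists x | rewrite sE].
exists (xget 1 c); first exact: map_f.
have [n Wn <-] : c (xget 1 c) by apply: xgetPex; exists (x * 1), 1 => //; exact: sub1.
by rewrite invgM mulgVK; exact: subV.
Qed.

(** A subgroup containing R is a union of cosets of R, so D is recovered from the representatives
    lying in it. *)
Lemma finite_between n V R : subgroup V -> cov n V R ->
  finite_set [set D : set G | [/\ subgroup D, R `<=` D & D `<=` V]].
Proof.
move=> sV [s [_ sP]].
pose F (T : set G) : set G := [set x | V x /\ exists2 f, T f & R (f^-1 * x)].
apply: (@sub_finite_set _ _ (F @` [set T | T `<=` [set` s]])); last first.
  exact/finite_image/finite_powerset/finite_seq.
move=> D [sD RD DV]; exists (D `&` [set` s]); first by move=> x [].
apply/seteqP; split=> x.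
  move=> [Vx [f [Df _] /RD Dfx]]; rewrite -(mulVKg f x); exact: subM.
move=> Dx; split; first exact: DV.
have [f fs Rfx] := sP x (DV x Dx); exists f => //; split=> //.
have -> : f = x * (f^-1 * x)^-1 by rewrite invgM invgK mulVKg.
by apply: subM => //; apply: subV => //; exact: RD.
Qed.

(** A transversal indexed by a finite type: the exact index, where [cov] gives an upper bound. *)
Definition ind n V W := exists (I : finType) (r : I -> G),
  [/\ #|I| = n, forall i, V (r i), forall i j, W ((r i)^-1 * r j) -> i = j
    & forall x, V x -> exists i, W ((r i)^-1 * x)].

Lemma ind_cov n V W : ind n V W -> cov n V W.
Proof.
move=> [I [r [<- _ _ rP]]]; exists [seq r i | i <- enum I].
split; first by rewrite size_map cardE.
by move=> x /rP[i Wx]; exists (r i) => //; apply: map_f; rewrite mem_enum.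
Qed.

Lemma ind_le n m V W : subgroup W -> ind n V W -> ind m V W -> n <= m.
Proof.
move=> sW [I [r [<- rV rinj _]]] [J [q [<- _ _ qP]]].
have [h hP] := choice (fun i => qP (r i) (rV i)).
apply: (@leq_card _ _ h) => i i' hE; apply: rinj.
have := subVM sW (hP i); rewrite hE => /(_ _ (hP i')).
by rewrite invgM invgK -mulgA mulVKg.
Qed.

Lemma ind_uniq n m V W : subgroup W -> ind n V W -> ind m V W -> n = m.
Proof. by move=> sW i j; apply/eqP; rewrite eqn_leq (ind_le sW i j) (ind_le sW j i). Qed.

Lemma ind_mul n m V W Z : subgroup V -> W `<=` V -> Z `<=` W -> subgroup W ->
  ind n V W -> ind m W Z -> ind (n * m) V Z.
Proof.
move=> sV WV ZW sW [I [r [<- rV rinj rP]]] [J [q [<- qW qinj qP]]].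
exists (I * J)%type, (fun p => r p.1 * q p.2); split.
- by rewrite card_prod.
- by move=> p; apply: subM => //; exact/WV.
- move=> [i j] [i' j'] /= Zp.
  have ii' : i = i'.
    apply: rinj; have := subM sW (qW j) (subM sW (ZW _ Zp) (subV sW (qW j'))).
    by rewrite invgM !mulgA mulgV mul1g mulgK.
  by move: Zp; rewrite ii' invgM -mulgA mulKg => /qinj ->.
- move=> x /rP[i /qP[j Zx]]; exists (i, j) => /=.
  by rewrite invgM -mulgA.
Qed.

Lemma ind_cj g n V W : ind n V W -> ind n (cj g V) (cj g W).
Proof.
move=> [I [r [<- rV rinj rP]]]; exists I, (fun i => r i ^ g^-1); split=> //.
- by move=> i; rewrite /cj /= conjgKV.
- by move=> i j; rewrite /cj /= conjMg conjVg !conjgKV => /rinj.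
- by move=> x /rP[i Wx]; exists i; rewrite /cj /= conjMg conjVg conjgKV.
Qed.

(** A cover of minimal size has no repetition and no two representatives of one coset, since one of
    them could be removed. *)
Lemma ind_ex n V W : subgroup W -> V 1 -> cov n V W ->
  exists m, [/\ 0 < m, m <= n & ind m V W].
Proof.
move=> sW V1 cn.
have ex : exists n, `[< cov n V W >] by exists n; apply/asboolP.
case: (ex_minnP ex) => m /asboolP cm mmin.
have mn : m <= n by apply: mmin; exact/asboolP.
have [s [sm sV sP]] := cov_inv sW cm.
have min t : (forall x, V x -> exists2 f, f \in t & W (f^-1 * x)) -> m <= size t.
  by move=> tP; apply: mmin; apply/asboolP; exists t.
have sE : size s = m by apply/eqP; rewrite eqn_leq sm min.
have us : uniq s.
  rewrite -[uniq s]negbK -ltn_size_undup -leqNgt sE; apply: min => x /sP[f fs Wf].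
  by exists f; rewrite ?mem_undup.
exists m; split=> //.
  by rewrite -sE; have [f + _] := sP 1 V1; case: (s).
exists 'I_(size s), (fun i : 'I_(size s) => nth 1 s i); split; first by rewrite card_ord.
- by move=> i; apply: sV; exact: mem_nth.
- move=> i j Wij; apply: contrapT => ij.
  have nij : nth 1 s i != nth 1 s j by rewrite nth_uniq //; apply/eqP => /ord_inj.
  have : m <= size (rem (nth 1 s j) s).
    apply: min => x Vx; have [f fs Wf] := sP x Vx.
    have [fE|fj] := eqVneq f (nth 1 s j); last by exists f => //; exact: rem_mem.
    exists (nth 1 s i); first by apply: rem_mem => //; exact: mem_nth.
    by have := subM sW Wij Wf; rewrite fE -mulgA mulVKg.
  rewrite size_rem; last exact: mem_nth.
  have s0 : 0 < size s by apply: leq_trans (ltn_ord i).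
  by rewrite -sE; case: (size s) s0 => // k _; rewrite ltnn.
- move=> x /sP[f fs Wf]; have := fs; rewrite -index_mem => fi.
  by exists (Ordinal fi); rewrite /= nth_index.
Qed.

End Cosets.

(** * Subgroups of bounded index and compact normalisers *)

Section FiniteQuotients.
Variable G : topologicalGroupType.
Hypothesis lfqtG : locally_finite_quotient_type G.
Hypothesis no_inf_quot : forall O : set G,
  subgroup O -> open O -> ~ has_infinite_discrete_quotient O.
Implicit Types (D R V W X Z : set G).

Definition cosub V := [/\ subgroup V, open V & compact V].

Lemma cosubI V W : cosub V -> cosub W -> cosub (V `&` W).
Proof.
move=> [sV oV cV] [sW oW cW]; split; [exact: subI | exact: openI |].
by apply: compact_closedI => //; exact: open_closed_sub.
Qed.

Lemma cosub_cj g V : cosub V -> cosub (cj g V).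
Proof.
by move=> [? ? ?]; split; [exact: sub_cj | exact: open_cj | exact: compact_cj].
Qed.

Lemma cosub_cov V W : cosub V -> cosub W -> exists n, cov n V W.
Proof. by move=> [_ _ cV] [sW oW _]; exact: compact_cov. Qed.

Lemma finite_normal_subs V n : cosub V ->
  finite_set [set R | [/\ normal_subgroup V R, open R & cov n V R]].
Proof.
move=> [sV oV cV].
apply: (@sub_finite_set _ _ (\bigcup_(i in `I_n.+1)
   [set N | [/\ normal_subgroup V N, open N & cosets V N #= `I_i]])).
  move=> R [nR oR cR]; have [sR _ _] := nR.
  by have [m mn cm] := cosets_cov sR cR; exists m.
by apply: bigcup_finite => [|i _]; [exact: finite_II | exact: lfqtG].
Qed.

Definition index_subs V n : set (set G) :=
  [set D | [/\ subgroup D, open D, D `<=` V & cov n V D]].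

(** Finite quotient type speaks of normal subgroups only. The core of D in V has index at most n^n,
    so finitely many cores occur, and finitely many subgroups lie between a core and V. *)
Lemma finite_index_subs V n : cosub V -> finite_set (index_subs V n).
Proof.
move=> cV; have [sV oV _] := cV.
apply: (@sub_finite_set _ _
  (\bigcup_(R in [set R | [/\ normal_subgroup V R, open R & cov (n ^ n) V R]])
  [set D | [/\ subgroup D, R `<=` D & D `<=` V]])); last first.
  apply: bigcup_finite; first exact: finite_normal_subs.
  by move=> R [_ _ cR]; exact: finite_between cR.
move=> D [sD oD DV cD].
have [s [sn sV' sP]] := core_cap sV sD cD.
exists (V `&` cap_cj s D); last first.
  by split=> // x [Vx /sP/(_ (sub1 sV))]; rewrite conjg1.
have sS : subgroup (V `&` cap_cj s D) by apply: subI => //; exact: sub_cap_cj.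
split.
- split=> // x d Vx [Vd sd]; split; first exact: sub_conj.
  move=> f fs; rewrite /cj /= -conjgM; apply: sP sd _.
  by apply: subM => //; exact: sV'.
- by apply: openI => //; exact: open_cap_cj.
- apply: (@cov_leq _ (n ^ size s)).
    by case: (n) sn => [|k] sn; [move: sn; rewrite leqn0 => /eqP-> | rewrite leq_pexp2l].
  apply: (covI (sub_cap_cj s sD) sV (@subset_refl _ V)).
  apply: cov_cap_cj => // f fs; rewrite -(cj_id sV (sV' f fs)); exact: cov_cj.
Qed.

(** D is open and normal in its normaliser, so the quotient is discrete and hence finite. *)
Lemma compact_normaliser D : cosub D -> cosub (normaliser D).
Proof.
move=> [sD oD cD].
have DN : D `<=` normaliser D by rewrite normaliserE => x Dx; exact: cj_id.
have sN := sub_normaliser D.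
have oN : open (normaliser D) by apply: open_sub oD _ _ => //; exact: sub1.
split=> //.
have fin : finite_set (cosets (normaliser D) D).
  apply: contrapT => inf; apply: (no_inf_quot sN oN); exists D; split=> //.
  by split=> // x n; rewrite normaliserE /= => xN; rewrite -{1}xN.
have [n cn] := cov_cosets sD fin.
have [K cK NK] := bdd_cov cD cn.
by apply: subclosed_compact cK NK; exact: open_closed_sub.
Qed.

End FiniteQuotients.

(** * Unimodularity *)

Section Unimodular.
Variable G : topologicalGroupType.
Hypothesis no_inf_quot : forall O : set G,
  subgroup O -> open O -> ~ has_infinite_discrete_quotient O.
Variable V : set G.
Hypothesis cV : cosub V.
Implicit Types (g h : G) (Z : set G).


(* The Haar measures of gVg^-1 and V are in the ratio q. *)
Definition modrel g (q : rat) := exists Z a b,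
  [/\ cosub Z, Z `<=` V `&` cj g V, ind a V Z, ind b (cj g V) Z &
      [/\ (0 < a)%N, (0 < b)%N & q = (b%:R / a%:R)%R]].

Lemma cosub_ind W Z : cosub W -> cosub Z -> Z `<=` W -> exists m, 0 < m /\ ind m W Z.
Proof.
move=> cW cZ ZW; have [n cn] := cosub_cov cW cZ.
have [sW _ _] := cW; have [sZ _ _] := cZ.
by have [m [m0 _ im]] := ind_ex sZ (sub1 sW) cn; exists m.
Qed.

Lemma natr_neq0 n : (0 < n)%N -> (n%:R != 0 :> rat)%R.
Proof. by move=> n0; rewrite Num.Theory.pnatr_eq0 -lt0n. Qed.

Lemma modrel_ex g : exists q, modrel g q.
Proof.
have cgV : cosub (cj g V) by exact: cosub_cj.
have cZ := cosubI cV cgV.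
have [a [a0 ia]] := cosub_ind cV cZ (@subIsetl _ _ _).
have [b [b0 ib]] := cosub_ind cgV cZ (@subIsetr _ _ _).
by exists (b%:R / a%:R)%R, (V `&` cj g V), a, b; split.
Qed.

(** Indices are multiplicative, so both fractions can be recomputed with the intersection of the
    witnesses [Z] and [Y]. *)
Lemma modrel_uniq g q r : modrel g q -> modrel g r -> q = r.
Proof.
move=> [Z [a [b [cZ ZV aZ bZ [a0 b0 ->]]]]] [Y [c [d [cY YV cY' dY [c0 d0 ->]]]]].
have cX := cosubI cZ cY; set X := Z `&` Y in cX.
have [sV _ _] := cV; have [sZ _ _] := cZ; have [sY _ _] := cY; have [sX _ _] := cX.
have [p [p0 pX]] := cosub_ind cZ cX (@subIsetl _ _ _).
have [e [e0 eX]] := cosub_ind cY cX (@subIsetr _ _ _).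
have sgV := sub_cj g sV.
have E1 : (a * p = c * e)%N.
  apply: (ind_uniq sX).
    by apply: (ind_mul sV _ _ sZ aZ pX) => [x /ZV[]|x []].
  by apply: (ind_mul sV _ _ sY cY' eX) => [x /YV[]|x []].
have E2 : (b * p = d * e)%N.
  apply: (ind_uniq sX).
    by apply: (ind_mul sgV _ _ sZ bZ pX) => [x /ZV[]|x []].
  by apply: (ind_mul sgV _ _ sY dY eX) => [x /YV[]|x []].
apply/eqP; rewrite GRing.eqr_div ?natr_neq0 // -!GRing.natrM Num.Theory.eqr_nat.
by rewrite -(@eqn_pmul2r (p * e)) ?muln_gt0 ?p0 // mulnACA E2 -E1 mulnACA (mulnC e) mulnC.
Qed.

(** Conjugated by g, the witness for h compares gVg^-1 with (gh)V(gh)^-1; its intersection with the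
    witness for g serves for gh. *)
Lemma modrelM g h q r : modrel g q -> modrel h r -> modrel (g * h) (q * r)%R.
Proof.
move=> [Z [a [b [cZ ZV aZ bZ [a0 b0 ->]]]]] [Y [c [d [cY YV cY' dY [c0 d0 ->]]]]].
have cgY : cosub (cj g Y) by exact: cosub_cj.
have cX := cosubI cZ cgY; set X := Z `&` cj g Y in cX.
have [sV _ _] := cV; have [sZ _ _] := cZ; have [sgY _ _] := cgY; have [sX _ _] := cX.
have [p [p0 pX]] := cosub_ind cZ cX (@subIsetl _ _ _).
have [e [e0 eX]] := cosub_ind cgY cX (@subIsetr _ _ _).
have XZ : X `<=` Z by move=> x [].
have XY : X `<=` cj g Y by move=> x [].
have sgV := sub_cj g sV.
have YV1 : cj g Y `<=` cj g V by apply/cjS => x /YV[].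
have YV2 : cj g Y `<=` cj g (cj h V) by apply/cjS => x /YV[].
have E : (b * p = c * e)%N.
  apply: (ind_uniq sX).
    by apply: (ind_mul sgV _ XZ sZ bZ pX) => x /ZV[].
  by apply: (ind_mul sgV YV1 XY sgY _ eX); exact: ind_cj.
exists X, (a * p)%N, (d * e)%N; split=> //.
- move=> x [Zx gYx]; split; first by have [] := ZV _ Zx.
  by rewrite cjM; exact: YV2.
- by apply: (ind_mul sV _ XZ sZ aZ pX) => x /ZV[].
- rewrite cjM; apply: (ind_mul _ YV2 XY sgY _ eX); first exact/sub_cj/sub_cj.
  exact: ind_cj.
split; rewrite ?muln_gt0 ?a0 ?p0 ?d0 ?e0 //.
apply/eqP; rewrite GRing.mulf_div GRing.eqr_div -?GRing.natrM ?natr_neq0 ?muln_gt0 ?a0 ?p0 //.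
by rewrite Num.Theory.eqr_nat (mulnC b) mulnACA E (mulnC c e) mulnACA.
Qed.

Lemma modrel_id g : V g -> modrel g 1%R.
Proof.
move=> Vg; have [sV _ _] := cV.
have [m [m0 im]] := cosub_ind cV cV (@subset_refl _ _).
exists V, m, m; rewrite cj_id //; split=> //; split=> //.
by rewrite GRing.divff // natr_neq0.
Qed.

(** The ratio is a homomorphism to the positive rationals whose kernel K contains V and so is open.
    A value other than 1 has infinitely many distinct powers, which would make G/K an infinite
    discrete quotient. *)
Lemma modrel1 g : modrel g 1%R.
Proof.
have [sV oV _] := cV.
pose K := [set h | modrel h 1%R].
have KV h : K h -> K h^-1.
  move=> Kh; have [q hq] := modrel_ex h^-1.
  have := modrelM hq Kh; rewrite mulVg GRing.mulr1 => hq1.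
  by rewrite /K /= (modrel_uniq (modrel_id (sub1 sV)) hq1).
have sK : subgroup K.
  apply: mksub; first by apply: modrel_id; exact: sub1.
  by move=> x y /KV Kx Ky; have := modrelM Kx Ky; rewrite GRing.mulr1.
have oK : open K.
  by apply: (open_sub sK oV (sub1 sV)) => x; exact: modrel_id.
have nK : normal_subgroup setT K.
  split=> // x n _ Kn; have [q hq] := modrel_ex x; have [r hr] := modrel_ex x^-1.
  have E : (r * 1 * q = 1)%R.
    apply: (@modrel_uniq 1); last by apply: modrel_id; exact: sub1.
    by rewrite GRing.mulr1 -(mulVg x); exact: modrelM.
  by have := modrelM (modrelM hr Kn) hq; rewrite E -mulgA.
have [q hq] := modrel_ex g.
have [<-//|q1] := eqVneq q 1%R.
exfalso; apply: (no_inf_quot (subT G) openT); exists K; split=> // fin.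
have q0 : (0 < q)%R.
  by case: hq => Z [a [b [_ _ _ _ [a0 b0 ->]]]]; rewrite Num.Theory.divr_gt0 ?Num.Theory.ltr0n.
have hX n : modrel (g ^+ n) (q ^+ n)%R.
  elim: n => [|n IH]; first by apply: modrel_id; exact: sub1.
  by rewrite expgS GRing.exprS; exact: modrelM.
apply: infinite_nat.
apply: (@inj_finite_set _ _ _ (fun n : nat => [set g ^+ n * k | k in K]) _ _ _ fin);
  last first.
  by move=> n _; exists (g ^+ n).
move=> m n _ _ E; apply: (Num.Theory.ieexprIn q0 q1).
have : [set g ^+ m * k | k in K] (g ^+ m) by exists 1; [exact: sub1 | rewrite mulg1].
rewrite E => -[k Kk gE]; apply: (modrel_uniq (hX m)).
by have := modrelM (hX n) Kk; rewrite gE GRing.mulr1.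
Qed.

Lemma unimodular n g : cov n V (V `&` cj g V) -> cov n (cj g V) (V `&` cj g V).
Proof.
have [sV oV _] := cV; have cgV : cosub (cj g V) by exact: cosub_cj.
have cZ := cosubI cV cgV; have [sZ _ _] := cZ.
move=> cn; have [m [m0 mn im]] := ind_ex sZ (sub1 sV) cn.
have [b [b0 ib]] := cosub_ind cgV cZ (@subIsetr _ _ _).
have : modrel g (b%:R / m%:R)%R by exists (V `&` cj g V), m, b; split.
move=> /(modrel_uniq (modrel1 g))/esym/GRing.divr1_eq/eqP.
rewrite Num.Theory.eqr_nat => /eqP bm.
by apply: cov_leq mn _; apply: ind_cov; rewrite -bm.
Qed.
End Unimodular.

(** * Conjugates meeting a compact open subgroup in bounded index *)

Section BoundedIndex.
Variable G : topologicalGroupType.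
Hypothesis lfqtG : locally_finite_quotient_type G.
Hypothesis no_inf_quot : forall O : set G,
  subgroup O -> open O -> ~ has_infinite_discrete_quotient O.
Implicit Types (D V W : set G) (g : G).

(** Conjugation by g carries the intersection of V and g^-1Vg to that of V and gVg^-1. By
    unimodularity both have index at most n in V, so finitely many pairs occur; for a given pair, g
    lies in a translate of a compact normaliser. *)
Lemma bdd_bounded_index_self V n : cosub V -> bdd [set g | cov n V (cj g V)].
Proof.
move=> cV; have [sV oV _] := cV; set S := index_subs V n.
pose F (p : set G * set G) : set G := [set g | p.1 = V `&` cj g V /\ cj g p.2 = p.1].
apply: (@bddS _ _ (\bigcup_(p in S `*` S) F p)); last first.
  apply: bdd_bigcup; first by apply: finite_setX; exact: finite_index_subs.
  move=> [D T] [/= [sD oD DV cD] _].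
  have [[f [_ /= fD]]|noF] := pselect (exists f, F (D, T) f); last first.
    by apply: (@bddS _ _ set0); [move=> g Fg; apply: noF; exists g | exact: bdd0].
  have cosD : cosub D.
    by split=> //; have [_ _ cV'] := cV; exact: open_compact_sub cV' DV.
  have [_ _ cN] := compact_normaliser no_inf_quot cosD.
  apply: (@bddS _ _ (mulset (normaliser D) [set f])).
    move=> g [/= _ gD]; exists (g * f^-1), f; rewrite mulgVK; split=> //.
    by rewrite normaliserE /= cjM -{1}fD cjVK gD.
  by apply: bddM; [exists (normaliser D) | exact: bdd_set1].
move=> g /= cg; have sgV := sub_cj g sV; have sgV' := sub_cj g^-1 sV.
have cg1 : cov n V (V `&` cj g V) by exact: covI cg.
have cg2 : cov n V (V `&` cj g^-1 V).
  have := cov_cj g^-1 (unimodular no_inf_quot cV cg1).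
  by rewrite cjI !cjVK setIC.
exists (V `&` cj g V, V `&` cj g^-1 V).
  split; split=> //=; try exact: subI; try exact: subIsetl;
  by apply: openI => //; exact: open_cj.
by split=> //=; rewrite cjI cjK setIC.
Qed.

Lemma bdd_bounded_index V W n : cosub V -> cosub W -> bdd [set g | cov n (cj g V) W].
Proof.
move=> cV cW; have cVW := cosubI cV cW; have [e ce] := cosub_cov cW cVW.
(* Conjugating back by g^-1 compares V with the conjugate of [V n W] by g^-1, so the previous lemma
   for [V n W] bounds the inverses g^-1. *)
apply: (bddS _ (bddV (bdd_bounded_index_self (n * e) cVW))) => g /= cg.
have := cov_cj g^-1 (cov_trans cg ce); rewrite cjVK => cg'.
by apply: covS cg' => // x [].
Qed.

End BoundedIndex.

(** * Local factors *)

(** If bb' and cc' commute, the commutator of b and c, which lies in B, equals one of b' and c',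
    which lies in D. *)
Lemma comm_split (G : groupType) (B D : set G) (b c b' c' : G) : subgroup B -> subgroup D ->
  B `&` D `<=` [set 1] -> D `<=` 'C B -> B b -> B c -> D b' -> D c' ->
  commute (b * b') (c * c') -> commute b c.
Proof.
move=> sB sD BD1 DB Bb Bc Db' Dc' E.
suff : (c * b)^-1 * (b * c) = 1.
  by move=> /(congr1 (mul (c * b))); rewrite mulVKg mulg1.
apply: BD1; split; first by apply: subVM => //; exact: subM.
have -> : (c * b)^-1 * (b * c) = (c' * b') * (b' * c')^-1; last first.
  by apply: subM; [|exact: subM|apply: subV => //; exact: subM].
have cb : commute b' c by exact: DB.
have bc : commute c' b by exact: DB.
have {}E : b * c * (b' * c') = c * b * (c' * b').
  have -> : b * c * (b' * c') = b * b' * (c * c') by rewrite -(mulgA b c) (mulgA c) -cb !mulgA.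
  by rewrite E -(mulgA c c') (mulgA c') bc !mulgA.
apply: (mulIg (b' * c')); by rewrite mulgVK -mulgA E mulKg.
Qed.

Lemma set1_sub (G : groupType) (A : set G) : subgroup A -> A `<=` [set 1] -> A = [set 1].
Proof. by move=> sA A1; apply/seteqP; split=> // x ->; exact: sub1. Qed.

Section Factors.
Variable G : topologicalGroupType.
Hypothesis hausG : hausdorff_space G.
Hypothesis QZG : quasicentre G = [set 1].
Hypothesis centr_compact : forall H : set G,
  locally_normal H -> closed H -> H <> [set 1] -> compact (centraliser H).
Implicit Types (A B N O P Q V W X : set G) (g x y : G).

Lemma qz O x : open O -> O 1 -> O `<=` 'C [set x] -> x = 1.
Proof.
move=> oO O1 OC; have : quasicentre G x.
  by apply: (open_sub (sub_centr _) oO).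
by rewrite QZG.
Qed.

(* Local direct factors A are represented by the closed subgroups A = C(C(A)) with
   AC(A) open; as QZ(G) = 1, commensurate factors have the same representative. *)
Definition fac A := [/\ subgroup A, A <> [set 1], 'C A <> [set 1],
  'C ('C A) = A & open (mulset A ('C A))].

Lemma fac_centr A : fac A -> fac ('C A).
Proof.
move=> [sA A1 CA1 AE oA]; split=> //; rewrite ?AE //; first exact: sub_centr.
by rewrite -mulsetC.
Qed.

Lemma fac_cj g A : fac A -> fac (cj g A).
Proof.
move=> [sA A1 CA1 AE oA]; split; rewrite ?centr_cj.
- exact: sub_cj.
- by rewrite cj_eq1.
- by rewrite cj_eq1.
- by rewrite AE.
- by rewrite -cj_mulset; exact: open_cj.
Qed.

Lemma sub_fac A : fac A -> subgroup A. Proof. by case. Qed.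

Lemma sub_mfac A : fac A -> subgroup (mulset A ('C A)).
Proof. by move=> [sA _ _ _ _]; apply: sub_mulset => //; exact: sub_centr. Qed.

Lemma mfac1 A : fac A -> mulset A ('C A) 1.
Proof. by move=> /sub_mfac/sub1. Qed.

Lemma fac_sub_m A : fac A -> A `<=` mulset A ('C A).
Proof. by move=> _; apply: mulsetl; exact: (sub1 (sub_centr A)). Qed.

Lemma centr_sub_m A : fac A -> 'C A `<=` mulset A ('C A).
Proof. by move=> fA; apply: mulsetr; exact: (sub1 (sub_fac fA)). Qed.

Lemma fac_closed A : fac A -> closed A.
Proof. by move=> [_ _ _ <- _]; exact: closed_centr. Qed.

Lemma fac_locally_normal A : fac A -> locally_normal A.
Proof.
move=> fA; have [sA _ _ _ oA] := fA; split=> //.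
apply: (open_sub (sub_normaliser A) oA (mfac1 fA)).
move=> _ [a [b [Aa Cb ->]]]; apply: subM; first exact: sub_normaliser.
  by rewrite normaliserE; exact: cj_id.
rewrite normaliserE /=; apply/seteqP; split=> x.
  rewrite /cj /= => Ax; suff <- : x ^ b = x by [].
  by have := Cb _ Ax; rewrite /commute {1}conjgE mulVKg => /mulIg <-.
by move=> Ax; rewrite /cj /= conjgE -(Cb x Ax) mulKg.
Qed.

Lemma compact_centr_fac A : fac A -> compact ('C A).
Proof.
move=> fA; apply: centr_compact; [exact: fac_locally_normal|exact: fac_closed|].
by case: fA.
Qed.

Lemma compact_fac A : fac A -> compact A.
Proof. by move=> fA; have [_ _ _ <- _] := fA; exact/compact_centr_fac/fac_centr. Qed.

Lemma cosub_mfac A : fac A -> cosub (mulset A ('C A)).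
Proof.
move=> fA; split; first exact: sub_mfac; first by case: fA.
by apply: compact_mulset; [exact: compact_fac | exact: compact_centr_fac].
Qed.

Lemma fac_capC A : fac A -> A `&` 'C A `<=` [set 1].
Proof.
move=> fA x [Ax Cx]; have [sA _ _ AE oA] := fA.
apply: (qz oA (mfac1 fA)) => _ [a [b [Aa Cb ->]]] _ ->.
apply/commute_sym/commuteM; first exact: Cx.
by apply/commute_sym/(Cb x Ax).
Qed.

(** The product is compact, hence closed, and has finite index in the open subgroup AC(A). *)
Lemma open_mul_parts A O1 O2 : fac A -> subgroup O1 -> open O1 -> subgroup O2 -> open O2 ->
  open (mulset (A `&` O1) ('C A `&` O2)).
Proof.
move=> fA sO1 oO1 sO2 oO2; have [sA _ _ _ oA] := fA.
have cC := compact_centr_fac fA; have cA := compact_fac fA.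
have [n cn] := compact_cov sO1 oO1 cA; have [m cm] := compact_cov sO2 oO2 cC.
have [s [_ sA' sP]] := cov_inv sO1 cn; have [t [_ tC tP]] := cov_inv sO2 cm.
have sub2 : 'C A `&` O2 `<=` 'C (A `&` O1).
  by move=> x [Cx _]; apply: centrS Cx => y [].
have sM := sub_mulset (subI sA sO1) (subI (sub_centr A) sO2) sub2.
apply: (@open_of_cov _ (size s * size t) _ (mulset A ('C A))) => //; last 2 first.
- exact: mfac1.
- exists [seq f * h | f <- s, h <- t]; split; first by rewrite size_allpairs.
  move=> _ [a [b [Aa Cb ->]]]; have [f fs Of] := sP a Aa; have [h ht Oh] := tP b Cb.
  exists (f * h); first exact: allpairs_f.
  exists (f^-1 * a), (h^-1 * b); split.
  + by split=> //; apply: subVM => //; exact: sA'.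
  + by split=> //; apply: (subVM (sub_centr A)) => //; exact: tC.
  + have Ch : commute h^-1 (f^-1 * a).
      have Ch := subV (sub_centr A) (tC h ht).
      by apply: Ch; apply: subVM => //; exact: sA'.
    by rewrite invgM -!mulgA (mulgA f^-1) mulgA Ch !mulgA.
- apply: compact_closed => //; apply: compact_mulset; apply: compact_closedI => //;
  exact: open_closed_sub.
Qed.

Lemma centr_parts A O1 O2 x : fac A -> subgroup O1 -> open O1 -> subgroup O2 -> open O2 ->
  'C (A `&` O1) x -> 'C ('C A `&` O2) x -> x = 1.
Proof.
move=> fA sO1 oO1 sO2 oO2 C1 C2.
apply: (@qz (mulset (A `&` O1) ('C A `&` O2))).
- exact: open_mul_parts.
- exists 1, 1; rewrite mulg1; split=> //; split; apply: sub1 => //.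
    by case: fA.
  exact: sub_centr.
move=> _ [a [b [Aa Cb ->]]] _ ->; apply/commute_sym/commuteM; [exact: C1 | exact: C2].
Qed.

(* For g in C(A n O) and x in A, the commutator of g and x centralises both A n O (after
   shrinking O) and an open subgroup of C(A). *)
Lemma centr_open A O : fac A -> subgroup O -> open O -> 'C (A `&` O) = 'C A.
Proof.
move=> fA sO oO; apply/seteqP; split; last by apply: centrS => x [].
have [sA _ _ AE oA] := fA; have cM := cosub_mfac fA; have [sM _ ccM] := cM.
have [n cn] := compact_cov sO oO ccM.
have [s [_ sM' sP]] := core_cap sM sO cn.
set O' := cap_cj s O in sP.
(* X is normalised by A, unlike the intersection of A and O, and still contains an open subgroup of
   A. *)
pose X := A `&` [set x | forall y, mulset A ('C A) y -> O (x ^ y)].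
have AX : A `&` (mulset A ('C A) `&` O') `<=` X.
  by move=> x [Ax [_ O'x]]; split=> // y My; exact: sP.
have XA x y : X x -> A y -> X (x ^ y).
  move=> [Ax Xx] Ay; split; first exact: sub_conj.
  move=> z Mz; rewrite -conjgM; apply: Xx; apply: subM => //; exact: fac_sub_m.
have XO : X `<=` A `&` O.
  by move=> x [Ax Xx]; split=> //; have := Xx 1 (mfac1 fA); rewrite conjg1.
have sMO : subgroup (mulset A ('C A) `&` O') by apply: subI => //; exact: sub_cap_cj.
have oMO : open (mulset A ('C A) `&` O') by apply: openI => //; exact: open_cap_cj.
have XM x : 'C X x -> mulset A ('C A) x -> 'C A x.
  move=> Cx [a [b [Aa Cb xE]]].
  suff a1 : a = 1 by rewrite xE a1 mul1g.
  apply: (@centr_parts A _ setT) => //; [exact: sMO|exact: oMO|exact: subT|exact: openT| |].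
    move=> y /AX Xy; have -> : a = x * b^-1 by rewrite xE mulgK.
    have CXb : 'C X b by apply: centrS Cb => z [].
    exact: (subM (sub_centr X) Cx (subV (sub_centr X) CXb) _ Xy).
  by move=> y [Cy _]; exact/commute_sym/Cy.
suff XC : 'C X `<=` 'C A by apply: subset_trans XC; exact: centrS.
move=> g Cg x Ax.
suff : g^-1 * g ^ x = 1.
  by rewrite -commgEl => E; rewrite /commute commgC E mulg1.
have Cgx : 'C X (g ^ x).
  move=> y Xy; apply/(commuteJ _ _ x^-1); rewrite conjgK; apply: Cg.
  by apply: XA => //; exact: subV.
have sgM := sub_cj g^-1 sM; have ogM : open (cj g^-1 (mulset A ('C A))) by exact: open_cj.
(* The commutator of g and x centralises X. For y in C(A) with gyg^-1 in AC(A), gyg^-1 centralises X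
   because g and y do, hence A by [XM]; so y commutes with g^-1x^-1g as well as with x. *)
apply: (@centr_parts A _ _ _ fA sMO oMO sgM ogM).
  by move=> y /AX Xy; exact: (subVM (sub_centr X) Cg Cgx _ Xy).
move=> y [Cy My].
have gy : 'C A (y ^ g^-1).
  apply: XM My => z Xz; apply/(commuteJ _ _ g); rewrite conjgKV.
  have -> : z ^ g = z by rewrite conjgE -(Cg z Xz) mulKg.
  by apply: centrS Cy _ Xz => t [].
have -> : g^-1 * g ^ x = (x^-1) ^ g * x by rewrite !conjgE !mulgA.
apply/commute_sym/commuteM; last exact: Cy.
by apply/(commuteJ _ _ g^-1); rewrite conjgK; apply: gy; exact: subV.
Qed.

(** The B-component of an element of N commutes with the part of C(N) inside BC(B). That part is
    open in C(N), so by [centr_open] the component lies in C(C(N)) = N. *)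
Lemma fac_split N B : fac N -> fac B ->
  N `&` mulset B ('C B) `<=` mulset (N `&` B) (N `&` 'C B).
Proof.
move=> fN fB x [Nx [b [b' [Bb Cb' xE]]]].
have sB := sub_fac fB; have sC := sub_centr B; have [sN _ _ NE _] := fN.
have Nb : N b.
  have oB : open (mulset B ('C B)) by case: fB.
  rewrite -NE -(centr_open (fac_centr fN) (sub_mfac fB) oB).
  move=> h [CN [c [c' [Bc Cc' hE]]]]; rewrite hE in CN *.
  apply: commuteM; last exact/commute_sym/Cc'.
  apply: (comm_split sB sC (fac_capC fB) (fun=> id) Bb Bc Cb' Cc').
  by rewrite -xE; apply/commute_sym/CN.
exists b, b'; split=> //; split=> //.
by rewrite -(mulKg b b') -xE; exact: subVM.
Qed.

(** By [fac_split] the part of N inside BC(B) centralises B. Being open in N, it has the same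
    centraliser as N, so B centralises N. *)
Lemma fac_disjoint N B : fac N -> fac B -> N `&` B `<=` [set 1] -> N `<=` 'C B.
Proof.
move=> fN fB NB1; have [sN _ _ NE _] := fN; have [sB _ _ BE oB] := fB.
have NC : N `&` mulset B ('C B) `<=` 'C B.
  move=> x /(fac_split fN fB)[a [b [Na [_ Cb] ->]]].
  by rewrite (NB1 _ Na) mul1g.
rewrite -NE; apply: centrS; rewrite -(centr_open fN (sub_mfac fB) oB).
by rewrite -{1}BE; exact: centrS.
Qed.

(** For openness: the part of N inside BC(B) is the product of its parts in B and in C(B), and the
    latter lies in C(N n B), as does C(N). *)
Lemma fac_meet N B : fac N -> fac B -> N `&` B <> [set 1] -> fac (N `&` B).
Proof.
move=> fN fB NB; have [sN N1 CN1 NE oN] := fN; have [sB _ _ BE oB] := fB.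
have CS : 'C N `<=` 'C (N `&` B) by apply: centrS => x [].
split=> //; first exact: subI.
- by move=> E; apply: CN1; apply: set1_sub; [exact: sub_centr | rewrite -E].
- apply/seteqP; split; last exact: sub_centr2.
  move=> x Cx; split; [rewrite -NE | rewrite -BE]; apply: centrS Cx => //.
  by apply: centrS => y [].
- apply: (@open_sub _ _ (mulset (N `&` mulset B ('C B)) ('C N `&` setT))).
  + by apply: sub_mulset; [exact: subI | exact: sub_centr|].
  + by apply: open_mul_parts => //; [exact: sub_mfac | exact: subT | exact: openT].
  + exists 1, 1; rewrite mulg1; split=> //; split=> //.
    * exact: sub1.
    * exact: mfac1.
    * exact: (sub1 (sub_centr N)).
  + apply: mulset_sub; first by apply: sub_mulset; [exact: subI | exact: sub_centr|].
      move=> x /(fac_split fN fB)[a [b [Na [Nb Cb] ->]]]; apply: mulsetI => //.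
      by apply: centrS Cb => y [].
    by move=> x [Cx _]; apply: mulsetr; [exact: (sub1 (subI sN sB)) | exact: CS].
Qed.

Hypothesis lfqtG : locally_finite_quotient_type G.
Hypothesis no_inf_quot : forall O : set G,
  subgroup O -> open O -> ~ has_infinite_discrete_quotient O.

(** Taking centralisers, gBg^-1 lies in C(Q) and gC(B)g^-1 in C(P). As C(Q) is compact, it is
    covered by n cosets of PC(P), with n independent of g; then so is the conjugate of BC(B), and
    [bdd_bounded_index] applies. *)
Lemma bdd_interval P Q B : fac P -> fac Q -> fac B ->
  bdd [set g | P `<=` cj g B /\ Q `<=` cj g ('C B)].
Proof.
move=> fP fQ fB; have [sP _ _ _ oP] := fP; have sMP := sub_mfac fP.
have [n cn] := compact_cov sMP oP (compact_centr_fac fQ).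
have bd := bdd_bounded_index lfqtG no_inf_quot n (cosub_mfac fB) (cosub_mfac fP).
apply: bddS bd.
move=> g [/= PB QB]; have [s [sn sP']] := cn.
have [_ _ _ BE _] := fac_cj g fB.
exists s; split=> // x; rewrite cj_mulset => -[a [b [Ba Cb xE]]].
have [f fs Mf] : exists2 f, f \in s & mulset P ('C P) (f^-1 * a).
  by apply: sP'; apply: (centrS QB); rewrite -centr_cj BE.
exists f => //; rewrite xE mulgA; apply: subM => //.
by apply: centr_sub_m => //; apply: centrS PB _ _; rewrite centr_cj.
Qed.

End Factors.

(** * Finiteness of direct factors *)

Section Powers.
Variable G : topologicalGroupType.
Variable S : set G.
Hypothesis S1 : S 1.
Hypothesis SV : forall x, S x -> S x^-1.
Implicit Types (X : set G) (x y : G).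

(** As S contains 1, this is the ball of radius n for the word length in S. *)
Fixpoint pw n : set G := if n is m.+1 then mulset S (pw m) else [set 1].

Lemma pw1 n : pw n 1.
Proof. by elim: n => //= n IH; exists 1, 1; rewrite mulg1. Qed.

Lemma pw_add n m x y : pw n x -> pw m y -> pw (n + m) (x * y).
Proof.
elim: n x => [x /= ->|n IH x /= [s [z [Ss nz ->]]] my]; first by rewrite mul1g.
by rewrite -mulgA; apply: mulsetI => //; exact: IH.
Qed.

Lemma pw_split n m z : pw (n + m) z -> exists x y, [/\ pw n x, pw m y & z = x * y].
Proof.
elim: n z => [z mz|n IH z /= [s [w [Ss /IH[x [y [nx my ->]]] ->]]]].
  by exists 1, z; rewrite mul1g.
by exists (s * x), y; rewrite mulgA; split=> //; exact: mulsetI.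
Qed.

Lemma pw_S x : S x -> pw 1 x.
Proof. by move=> Sx; exists x, 1; rewrite mulg1. Qed.

Lemma pw_1 x : pw 1 x -> S x.
Proof. by move=> [s [y [Ss /= -> ->]]]; rewrite mulg1. Qed.

Lemma pwV n x : pw n x -> pw n x^-1.
Proof.
elim: n x => [x /= ->|n IH x [s [y [/SV Ss /IH ny ->]]]]; first by rewrite invg1.
by rewrite invgM -addn1; apply: pw_add => //; exact: pw_S.
Qed.

Lemma pw_leq n m : n <= m -> pw n `<=` pw m.
Proof. by move=> /subnKC <- x nx; rewrite -[x]mulg1; apply: pw_add => //; exact: pw1. Qed.

Lemma pw_compact n : compact S -> compact (pw n).
Proof.
by move=> cS; elim: n => [|n IH]; [exact: compact_set1 | exact: compact_mulset].
Qed.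

Lemma pw_all K : K `<=` S -> generated K = setT -> forall x, exists n, pw n x.
Proof.
move=> KS gK x; have : generated K x by rewrite gK.
move=> /(_ [set y | exists n, pw n y]); apply; split; last first.
  by move=> y /KS /pw_S; exists 1%N.
apply: mksub; first by exists 0%N.
by move=> y z [n /pwV ny] [m mz]; exists (n + m); exact: pw_add.
Qed.

Lemma bdd_pw K V X : K `<=` S -> generated K = setT -> subgroup V -> open V -> V `<=` S ->
  bdd X -> exists n, X `<=` pw n.
Proof.
move=> KS gK sV oV VS bX; have [k [s [_ sP]]] := cov_bdd sV oV bX.
have [n sn] : exists n, forall f, f \in s -> pw n f.
  elim: s {sP} => [|f s [n IH]]; first by exists 0%N.
  have [m mf] := pw_all KS gK f; exists (maxn m n) => h; rewrite in_cons => /orP[/eqP->|].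
    exact: pw_leq (leq_maxl _ _) _ mf.
  by move=> /IH; apply: pw_leq; exact: leq_maxr.
exists (n + 1)%N => x /sP[f fs Vfx]; rewrite -(mulVKg f x).
by apply: pw_add; [exact: sn | exact/pw_S/VS].
Qed.
End Powers.

Lemma exists_minimal (T : choiceType) (P : set (set T)) : finite_set P -> P !=set0 ->
  exists2 X, P X & forall Y, P Y -> Y `<=` X -> Y = X.
Proof.
move=> /finite_seqP[s ->]; elim: s => [[]//|X s IH _].
have [[Y Ys]|s0] := pselect ([set` s] !=set0); last first.
  exists X; first by rewrite /= mem_head.
  move=> Y /=; rewrite in_cons => /orP[/eqP//|Ys]; exfalso; apply: s0; by exists Y.
have [M Ms Mmin] := IH (ex_intro _ Y Ys).
have [XM|nXM] := pselect (X `<=` M).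
  exists X; first by rewrite /= mem_head.
  move=> Z /=; rewrite in_cons => /orP[/eqP//|Zs] ZX.
  have ZM := Mmin Z Zs (subset_trans ZX XM).
  by apply/seteqP; split=> //; rewrite ZM.
exists M; first by rewrite /= in_cons; apply/orP; right.
by move=> Z /=; rewrite in_cons => /orP[/eqP-> //|Zs]; exact: Mmin.
Qed.

Section FiniteFactors.
Variable G : topologicalGroupType.
Hypothesis hausG : hausdorff_space G.
Hypothesis nontrivG : [set: G] <> [set 1].
Hypothesis QZG : quasicentre G = [set 1].
Hypothesis no_compact_normal : forall K : set G,
  normal_subgroup setT K -> compact K -> K = [set 1].
Hypothesis lfqtG : locally_finite_quotient_type G.
Implicit Types (A B D F N O P Q R V W X : set G) (g s t x y : G).

Lemma not_bddT : ~ bdd [set: G].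
Proof.
move=> [K cK TK]; apply: nontrivG; apply: no_compact_normal.
  by split=> //; exact: subT.
by apply: subclosed_compact cK TK; exact: closedT.
Qed.

(** The intersection of all conjugates of V is a compact normal subgroup. *)
Lemma conj_core1 V x : cosub V -> (forall g, cj g V x) -> x = 1.
Proof.
move=> [sV oV cV]; suff KE : [set y | forall g, cj g V y] = [set 1].
  by move=> Vx; have : [set y | forall g, cj g V y] x by []; rewrite KE.
apply: no_compact_normal.
  split=> //.
    apply: mksub => [g|y z Vy Vz g]; first exact: (sub1 (sub_cj g sV)).
    exact: (subVM (sub_cj g sV) (Vy g) (Vz g)).
  by move=> y z _ Vz g; rewrite -[cj g V _]/(cj y (cj g V) z) -cjM; exact: Vz.
have -> : [set y | forall g, cj g V y] = \bigcap_(g in setT) cj g V.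
  by apply/seteqP; split=> y H g //; exact: H.
apply: (subclosed_compact _ cV).
  by apply: closed_bigI => g _; apply: closed_cj; exact: open_closed_sub.
by move=> y /(_ 1 I); rewrite cj1.
Qed.

(** The conjugate tVt^-1 depends only on the coset tV, so finitely many conjugates occur for t in
    X. *)
Lemma cov_cj_compact V X : cosub V -> compact X ->
  exists k, forall t, X t -> cov k V (cj t V).
Proof.
move=> cV cX; have [sV oV cV'] := cV; have [n [s [_ sP]]] := compact_cov sV oV cX.
have [k ks] : exists k, forall f, f \in s -> cov k V (cj f V).
  elim: s {sP} => [|f s [k IH]]; first by exists 0%N.
  have [m cm] := cosub_cov cV (cosub_cj f cV).
  exists (maxn m k) => h; rewrite in_cons => /orP[/eqP->|].
    exact: cov_leq (leq_maxl _ _) cm.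
  by move=> /IH; apply: cov_leq; exact: leq_maxr.
exists k => t /sP[f fs Vft]; rewrite -(mulVKg f t) cjM (cj_id sV Vft); exact: ks.
Qed.

Section Generated.
Variables (V K S : set G).
Hypothesis cV : cosub V.
Hypothesis SV : forall x, S x -> S x^-1.
Hypothesis KS : K `<=` S.
Hypothesis genK : generated K = setT.

(* As the conjugates of V intersect trivially, some conjugate of V does not contain F; take
   the first one along a word in S, so that its predecessor still contains F. *)
Lemma proper_bounded_index k F : (forall t, S t -> cov k V (cj t V)) ->
  F <> [set 1] -> subgroup F -> cov k F V ->
  exists x, ~ (F `<=` cj x V) /\ cov k F (cj x V).
Proof.
move=> kS F1 sF kF; apply: contrapT => /forallNP noX.
have pF n x : pw S n x -> F `<=` cj x V.
  elim: n x => [x /= ->|n IH x].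
    by apply: contrapT => FV; apply: (noX 1); rewrite cj1 in FV *.
  rewrite -addn1 => /pw_split[y [t [/IH Fy /pw_1 /kS ct ->]]].
  apply: contrapT => FV; apply: (noX (y * t)); split=> //.
  by rewrite cjM; apply: covS (cov_cj y ct).
apply: F1; apply: set1_sub => // x Fx; apply: (conj_core1 cV) => g.
by have [n ng] := pw_all SV KS genK g; exact: (pF n).
Qed.
End Generated.

(** Internal direct products; when O is compact and open, triviality of the intersection comes from
    QZ(G) = 1, see [dprod_cap]. *)
Definition dprod P R O :=
  [/\ subgroup P, subgroup R, R `<=` 'C P & O = mulset P R].

Definition dfactor O P := exists R, dprod P R O.

Lemma dprod_sym P R O : dprod P R O -> dprod R P O.
Proof. by move=> [sP sR RP ->]; split=> //; [exact: centr_sym | exact: mulsetC]. Qed.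

Lemma dprod_subl P R O : dprod P R O -> P `<=` O.
Proof. by move=> [_ sR _ ->]; apply: mulsetl; exact: sub1. Qed.

Lemma dprod_mulset P R N Z : dprod P R N -> subgroup Z -> Z `<=` 'C N ->
  dprod P (mulset R Z) (mulset N Z).
Proof.
move=> [sP sR RP NE] sZ ZN.
have PN : P `<=` N by rewrite NE; apply: mulsetl; exact: sub1.
have RN : R `<=` N by rewrite NE; apply: mulsetr; exact: sub1.
split=> //.
- by apply: sub_mulset => //; apply: subset_trans ZN _; exact: centrS.
- apply: mulset_sub => //; first exact: sub_centr.
  by apply: subset_trans ZN _; exact: centrS.
apply/seteqP; split=> [x [n [z [+ Zz ->]]]|_ [p [_ [Pp [r [z [Rr Zz ->]]] ->]]]].
  rewrite {1}NE => -[p [r [Pp Rr ->]]]; exists p, (r * z); rewrite mulgA; split=> //.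
  exact: mulsetI.
by exists (p * r), z; rewrite mulgA; split=> //; rewrite NE; exact: mulsetI.
Qed.

Section DirectFactors.
Variable O : set G.
Hypothesis cO : cosub O.

Lemma center1 x : 'C O x -> x = 1.
Proof.
have [sO oO _] := cO => Cx; apply: (qz QZG oO (sub1 sO)) => y Oy _ ->.
exact/commute_sym/Cx.
Qed.

Lemma dprod_cap P R : dprod P R O -> P `&` R `<=` [set 1].
Proof.
move=> [sP sR RP OE] x [Px Rx]; apply: center1; rewrite OE => h [p [r [Pp Rr ->]]].
by apply: commuteM; [exact: RP | exact/commute_sym/(RP r)].
Qed.

Lemma dprodE P R : dprod P R O -> P = O `&` 'C R.
Proof.
move=> dP; have [sP sR RP OE] := dP; apply/seteqP; split=> x.
  by move=> Px; split; [exact: (dprod_subl dP Px) | exact: (centr_sym RP Px)].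
move=> [Ox Cx]; move: Ox Cx; rewrite {1}OE => -[p [r [Pp Rr ->]]] Cpr.
suff -> : r = 1 by rewrite mulg1.
apply: center1; rewrite OE => h [q [t [Pq Rt ->]]].
apply: commuteM; first exact: RP.
have CRp : 'C R p^-1 by apply: (subV (sub_centr R)); exact: (centr_sym RP).
by have := subM (sub_centr R) CRp Cpr; rewrite mulKg => /(_ _ Rt).
Qed.

(** For x = ab with a in P' and b in R', [comm_split] shows that a commutes with R, and P is the
    centraliser of R in O. *)
Lemma dprod_split P R P' R' : dprod P R O -> dprod P' R' O ->
  P `<=` mulset (P `&` P') (P `&` R').
Proof.
move=> dP dP' x Px; have [sP sR RP OE] := dP; have [sP' sR' RP' OE'] := dP'.
have := dprod_subl dP Px; rewrite OE' => -[a [b [P'a R'b xE]]].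
have Pa : P a.
  rewrite (dprodE dP); split; first exact: (dprod_subl dP' P'a).
  move=> c Rc; have := dprod_subl (dprod_sym dP) Rc.
  rewrite OE' => -[c1 [c2 [P'c1 R'c2 cE]]]; rewrite cE.
  apply: commuteM; last exact/commute_sym/(RP' _ R'c2).
  apply: (comm_split sP' sR' (dprod_cap dP') RP' P'a P'c1 R'b R'c2).
  by rewrite -xE -cE; exact/commute_sym/(RP _ Rc).
exists a, b; split=> //; split=> //.
by rewrite -(mulKg a b) -xE; exact: subVM.
Qed.

Lemma dfactor_compact P : dfactor O P -> compact P.
Proof.
have [sO oO cO'] := cO; move=> [R /dprodE ->].
by apply: compact_closedI => //; exact: closed_centr.
Qed.

(* P is determined by the open subgroups X of index at most k containing it: if P is not
   contained in P', where O = P' x R', then P n R' is a nontrivial direct factor of O and has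
   a proper subgroup of index at most k, which extends to such an X containing P' but not P. *)
Lemma finite_dfactor V K S : cosub V -> compact S ->
  (forall x, S x -> S x^-1) -> K `<=` S -> generated K = setT ->
  finite_set (dfactor O).
Proof.
move=> cV cS SV KS genK; have [sO oO cO'] := cO; have [sV oV cV'] := cV.
have [k1 ck1] := compact_cov sV oV cO'; have [k2 ck2] := cov_cj_compact cV cS.
(* One bound serves for O against V and for V against its conjugates by single letters of S. *)
pose k := maxn k1 k2.
have ckO : cov k O V by apply: cov_leq ck1; exact: leq_maxl.
have ckS t : S t -> cov k V (cj t V) by move=> /ck2; apply: cov_leq; exact: leq_maxr.
pose F P : set (set G) := [set X | index_subs O k X /\ P `<=` X].
apply: (@inj_finite_set _ _ _ F [set Z | Z `<=` index_subs O k]); last 2 first.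
- by move=> P _ X [].
- by apply: finite_powerset; exact: finite_index_subs.
suff FS P P' : dfactor O P -> dfactor O P' -> F P = F P' -> P `<=` P'.
  by move=> P P'; rewrite !in_setE => dP dP' E; apply/seteqP; split; exact: FS.
move=> [R dP] [R' dP'] FE.
have [sP sR RP OE] := dP; have [sP' sR' RP' OE'] := dP'.
pose D := P `&` R'; have sD : subgroup D by exact: subI.
have [D1|D1] := pselect (D = [set 1]).
  move=> x /(dprod_split dP dP')[a [b [[_ P'a] Db ->]]].
  by have -> : b = 1; [rewrite -[_ = _]/([set 1] b) -D1 | rewrite mulg1].
exfalso.
have ckD : cov k D V by apply: covS ckO => // x [/(dprod_subl dP)].
have [x [nDx cDx]] := proper_bounded_index cV SV KS genK ckS D1 sD ckD.
have sRR' : subgroup (R `&` R') by exact: subI.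
(* E is a complement of D in O: by [dprod_split], R' is the product of D and its intersection with
   R. *)
pose E := mulset P' (R `&` R').
have sE : subgroup E.
  by apply: sub_mulset => // y [_]; exact: RP'.
have EC : E `<=` 'C D.
  apply: mulset_sub; first exact: sub_centr.
    by move=> y P'y z [_ R'z]; exact: (centr_sym RP').
  by move=> y [Ry _] z [Pz _]; exact: RP.
have ODE y : O y -> mulset D E y.
  rewrite OE' => -[p [r [P'p R'r ->]]].
  have [u [v [[R'u Pu] [R'v Rv] ->]]] := dprod_split (dprod_sym dP') dP R'r.
  exists u, (p * v); split=> //; first exact: mulsetI.
  by rewrite !mulgA; congr (_ * _); exact/commute_sym/(RP' u).
pose D' := D `&` cj x V; have sD' : subgroup D' by apply: subI => //; exact: sub_cj.
have ED' : E `<=` 'C D' by apply: subset_trans EC _; apply: centrS => y [].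
pose X := mulset D' E; have sX : subgroup X by exact: sub_mulset.
have cX : compact X.
  apply: compact_mulset.
    apply: compact_closedI.
      apply: compact_closedI; first by apply: dfactor_compact; exists R.
      apply: compact_closed => //; apply: dfactor_compact; exists P'; exact: dprod_sym.
    by apply: closed_cj; exact: open_closed_sub.
  apply: compact_mulset; first by apply: dfactor_compact; exists R'.
  apply: compact_closedI; first by apply: dfactor_compact; exists P; exact: dprod_sym.
  by apply: compact_closed => //; apply: dfactor_compact; exists P'; exact: dprod_sym.
have ckX : cov k O X.
  have [s [sk sP'']] := covI (sub_cj x sV) sD (@subset_refl _ D) cDx.
  exists s; split=> // y /ODE[d [e [Dd Ee ->]]]; have [f fs Df] := sP'' d Dd.
  by exists f => //; exists (f^-1 * d), e; rewrite mulgA.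
have iX : index_subs O k X.
  split=> //.
    by apply: open_of_cov ckX => //; [exact: compact_closed | exact: sub1].
  apply: mulset_sub => //; first by move=> y [[/(dprod_subl dP)]].
  apply: mulset_sub => //; first exact: dprod_subl dP'.
  by move=> y [/(dprod_subl (dprod_sym dP))].
have : F P' X.
  split=> // y P'y; apply: mulsetr; first exact: sub1.
  by apply: mulsetl => //; exact: sub1.
rewrite -FE => -[_ PX]; apply: nDx => f Df.
have [d [w [[Dd xd] Ew fE]]] := PX f (proj1 Df).
suff w1 : w = 1 by rewrite fE w1 mulg1.
(* An element of both D and E centralises E and D, hence O, and is therefore trivial. *)
have Dw : D w by rewrite -(mulKg d w) -fE; exact: subVM.
apply: center1 => h /ODE[a [b [Da Eb ->]]].
by apply: commuteM; [exact: EC | exact/commute_sym/(EC b)].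
Qed.

End DirectFactors.
End FiniteFactors.

(** * Translates of factors *)

Section Dynamics.
Variable G : topologicalGroupType.
Hypothesis hausG : hausdorff_space G.
Hypothesis nontrivG : [set: G] <> [set 1].
Hypothesis QZG : quasicentre G = [set 1].
Hypothesis no_compact_normal : forall K : set G,
  normal_subgroup setT K -> compact K -> K = [set 1].
Hypothesis lfqtG : locally_finite_quotient_type G.
Hypothesis no_inf_quot : forall O : set G,
  subgroup O -> open O -> ~ has_infinite_discrete_quotient O.
Hypothesis centr_compact : forall H : set G,
  locally_normal H -> closed H -> H <> [set 1] -> compact (centraliser H).
Variable K : set G.
Hypothesis cK : compact K.
Hypothesis genK : generated K = setT.
Variable A : set G.
Hypothesis fA : fac A.
Implicit Types (B D F N O P Q R W X : set G) (g s t x y : G).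

Let V := mulset A ('C A).
(** A compact symmetric generating set; since it contains V, passing to another representative of a
    coset of V costs one letter. *)
Let S := V `|` (K `|` [set x | K x^-1]).

Let cV : cosub V. Proof. exact: cosub_mfac. Qed.

Let cS : compact S.
Proof.
apply: compactU; first by case: cV.
apply: compactU => //.
suff -> : [set x | K x^-1] = (fun x => x^-1) @` K.
  by apply: image_compact => //; exact: invg_continuous.
apply/seteqP; split=> x /=; first by move=> Kx; exists x^-1; rewrite ?invgK.
by move=> [y Ky <-]; rewrite invgK.
Qed.

Let SV x : S x -> S x^-1.
Proof.
have [sV _ _] := cV.
move=> [Vx|[Kx|Kx]]; [left; exact: subV | right; right; rewrite /= invgK // | by right; left].
Qed.

Let KS : K `<=` S. Proof. by move=> x Kx; right; left. Qed.
Let VS : V `<=` S. Proof. by move=> x Vx; left. Qed.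
Let S1 : S 1. Proof. by left; have [sV _ _] := cV; exact: sub1. Qed.

(* If gsVs^-1g^-1 does not contain N although gVg^-1 does, then N meets gsV(gs)^-1 in a
   subgroup P x Q of bounded index with P in a conjugate of A and Q in one of C(A), both
   nontrivial.  Only finitely many pairs (P, Q) occur, and each forces gs into a compact
   set by bdd_interval. *)
Lemma almost_invariant N s : fac N ->
  bdd [set g | N `<=` cj g V /\ ~ (N `<=` cj (g * s) V)].
Proof.
move=> fN; have [sV oV cV'] := cV; have [sN _ _ NE _] := fN.
have [c cc] := cosub_cov cV (cosub_cj s cV).
pose M := mulset N ('C N).
have cM : cosub M by exact: cosub_mfac.
pose DF := \bigcup_(O in index_subs M c) dfactor O.
have finDF : finite_set DF.
  apply: bigcup_finite; first exact: finite_index_subs.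
  move=> O [sO oO OM _].
  have cO : cosub O by split=> //; have [_ _ cM'] := cM; exact: open_compact_sub cM' OM.
  exact: (finite_dfactor hausG QZG no_compact_normal lfqtG cO cV cS SV KS genK).
pose DFf := [set P | DF P /\ fac P].
have finDFf : finite_set (DFf `*` DFf).
  by apply: finite_setX; apply: sub_finite_set finDF => P [].
pose F (p : set G * set G) : set G :=
  [set h | p.1 `<=` cj h A /\ p.2 `<=` cj h ('C A)].
have bF : bdd (mulset (\bigcup_(p in DFf `*` DFf) F p) [set s^-1]).
  apply: bddM; last exact: bdd_set1.
  apply: bdd_bigcup => // -[P Q] [/= [_ fP] [_ fQ]].
  exact: bdd_interval.
apply: bddS bF => g [Ng nNgs].
exists (g * s), s^-1; rewrite mulgK; split=> //.
have fB : fac (cj (g * s) A) by exact: fac_cj.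
have BE : cj (g * s) V = mulset (cj (g * s) A) ('C (cj (g * s) A)).
  by rewrite cj_mulset centr_cj.
have sgV := sub_cj (g * s) sV; have ogV := open_cj (g * s) oV.
have NB : N `&` cj (g * s) A <> [set 1].
  move=> E; apply: nNgs; rewrite BE; apply: subset_trans (centr_sub_m fB).
  by apply: fac_disjoint => //; rewrite E.
have NC : N `&` 'C (cj (g * s) A) <> [set 1].
  move=> E; apply: nNgs; rewrite BE; apply: subset_trans (fac_sub_m fB).
  have [_ _ _ BEE _] := fB; rewrite -[X in _ `<=` X]BEE.
  by apply: fac_disjoint => //; [exact: fac_centr | rewrite E].
have fP := fac_meet hausG QZG centr_compact fN fB NB.
have fQ := fac_meet hausG QZG centr_compact fN (fac_centr fB) NC.
pose J := N `&` cj (g * s) V; have sJ : subgroup J by exact: subI.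
have JN : J `<=` N by move=> x [].
have dJ : dprod (N `&` cj (g * s) A) (N `&` 'C (cj (g * s) A)) J.
  split; [exact: sub_fac | exact: sub_fac | |].
    by move=> x [_ Cx] y [_ By]; exact: Cx.
  apply/seteqP; split; first by rewrite /J BE; exact: fac_split.
  apply: mulset_sub => // x [Nx Bx]; split=> //; rewrite BE.
    exact: (fac_sub_m fB).
  exact: (centr_sub_m fB).
(* Direct factors of J become direct factors of O, a subgroup of bounded index in the open group M,
   where finiteness is available. *)
pose O := mulset J ('C N).
have CNJ : 'C N `<=` 'C J by exact: centrS.
have OM : O `<=` M by exact: mulsetS.
(* As N lies in gVg^-1, at most c cosets of J cover N, because c cosets of sVs^-1 cover V. *)
have ckO : cov c M O.
  have : cov c N J.
    apply: (covI sgV sN (@subset_refl _ N)).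
    by apply: (covS Ng (@subset_refl _ _)); rewrite cjM; exact: cov_cj.
  move=> [t [tc tP]]; exists t; split=> // _ [n [z [Nn Cz ->]]].
  by have [f ft Jf] := tP n Nn; exists f => //; exists (f^-1 * n), z; rewrite mulgA.
have iO : index_subs M c O.
  split=> //; first by apply: sub_mulset => //; exact: sub_centr.
  suff -> : O = mulset (N `&` cj (g * s) V) ('C N `&` setT).
    by apply: open_mul_parts => //; [exact: subT | exact: openT].
  by rewrite setIT.
have dO P R : dprod P R J -> dfactor O P.
  by move=> dP; exists (mulset R ('C N)); apply: dprod_mulset; [|exact: sub_centr|].
exists (N `&` cj (g * s) A, N `&` 'C (cj (g * s) A)); last first.
  split=> /=; first by move=> x [].
  by rewrite -centr_cj => x [].
split; split=> //=; exists O => //; [exact: dO dJ | exact: dO (dprod_sym dJ)].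
Qed.

(** The exceptional g lie in finitely many cosets fV, so an open subgroup of N lies in all
    conjugates of V and is trivial. By [centr_open], C(N) is then all of G, and N = C(C(N)) is
    central, hence trivial. *)
Lemma not_cobdd N : fac N -> ~ bdd [set g | ~ (N `<=` cj g V)].
Proof.
move=> fN bN; have [sV oV cV'] := cV; have [n [s [_ sP]]] := cov_bdd sV oV bN.
have sO := sub_cap_cj s sV; have oO := open_cap_cj s oV.
have NO x : (N `&` cap_cj s V) x -> x = 1.
  move=> [Nx Ox]; apply: (conj_core1 no_compact_normal cV) => g.
  have [Ng|/sP[f fs Vf]] := pselect (N `<=` cj g V); first exact: Ng.
  by rewrite -(mulVKg f g) cjM (cj_id sV Vf); exact: Ox.
have [sN N1 _ NE _] := fN.
have CE := centr_open hausG QZG centr_compact fN sO oO.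
apply: N1; apply: set1_sub => // x; rewrite -NE -CE => Cx.
apply: (qz QZG openT) => // y _ _ ->; apply/commute_sym/Cx.
by move=> z /NO ->; exact: commute1.
Qed.

Definition indec P := forall Q R, dprod Q R P -> Q = [set 1] \/ R = [set 1].

Lemma indec_cj g P : indec P -> indec (cj g P).
Proof.
move=> iP Q R [sQ sR RQ PE].
have : dprod (cj g^-1 Q) (cj g^-1 R) P.
  split; [exact: sub_cj | exact: sub_cj | by rewrite centr_cj; apply/cjS |].
  by rewrite -cj_mulset -PE cjVK.
by move=> /iP; rewrite !cj_eq1.
Qed.

(** Direct factors of N are direct factors of NC(N), so they are finite in number and a minimal
    nontrivial one exists. *)
Lemma exists_indec N : fac N -> exists P, [/\ fac P, indec P & P `<=` N].
Proof.
move=> fN; have [sN N1 CN1 NE oN] := fN.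
have cM : cosub (mulset N ('C N)) by exact: cosub_mfac.
have N1s : N `&` 'C N `<=` [set 1] by exact: fac_capC.
have dN : dprod N [set 1] N.
  split=> //; first by apply: mksub => // x y /= -> ->; rewrite mulVg.
    by move=> x ->; exact: (sub1 (sub_centr N)).
  apply/seteqP; split=> [x Nx|_ [n [_ [Nn -> ->]]]]; last by rewrite mulg1.
  by exists x, 1; rewrite mulg1.
pose E := [set P | dfactor N P /\ P <> [set 1]].
have finE : finite_set E.
  apply: sub_finite_set (finite_dfactor hausG QZG no_compact_normal lfqtG cM cV cS SV KS genK).
  move=> P [[R dP] _]; exists (mulset R ('C N)).
  by apply: dprod_mulset; [|exact: sub_centr|].
have E0 : E !=set0 by exists N; split=> //; exists [set 1].
have [P [[R dP] P1] Pmin] := exists_minimal finE E0.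
have [sP sR RP NPR] := dP.
have PN : P `<=` N by exact: dprod_subl dP.
exists P; split=> //.
  split=> //.
  - move=> E1; apply: CN1; apply: set1_sub; first exact: sub_centr.
    by rewrite -E1; exact: centrS.
  (* An element of C(C(P)) lies in N = PR and commutes with R; its R-component is central in N,
     hence trivial. *)
  - apply/seteqP; split; last exact: sub_centr2.
    move=> x Cx; have : N x by rewrite -NE; apply: centrS Cx; exact: centrS.
    rewrite {1}NPR => -[p [r [Pp Rr xE]]].
    suff -> : x = p by [].
    rewrite xE; suff -> : r = 1 by rewrite mulg1.
    apply: N1s; split; first by rewrite NPR; apply: mulsetr => //; exact: sub1.
    rewrite NPR => h [q [t [Pq Rt ->]]]; apply: commuteM; first exact: RP.
    have Cp : 'C R p^-1 by apply: (subV (sub_centr R)); exact: (centr_sym RP Pp).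
    have Cx' : 'C R x by apply: centrS Cx => y /RP.
    by have := subM (sub_centr R) Cp Cx' _ Rt; rewrite xE mulKg; apply.
  - apply: (open_sub _ oN); first by apply: sub_mulset => //; exact: sub_centr.
      exact: (mfac1 fN).
    apply: mulset_sub; first by apply: sub_mulset => //; exact: sub_centr.
      rewrite NPR; apply: mulsetS => //.
    by apply: subset_trans (mulsetr (sub1 sP)); exact: centrS.
move=> Q1 Q2 [s1 s2 C12 PE].
have [->|n1] := pselect (Q1 = [set 1]); [by left | right].
have Q1P : Q1 `<=` P by rewrite PE; apply: mulsetl; exact: sub1.
have Q2P : Q2 `<=` P by rewrite PE; apply: mulsetr; exact: sub1.
have d1 : dfactor N Q1.
  by exists (mulset Q2 R); rewrite NPR; apply: dprod_mulset.
have Q1E : Q1 = P by exact: Pmin.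
apply: set1_sub => // x Q2x; apply: N1s; split; first exact/PN/Q2P.
rewrite NPR => h [p [r [Pp Rr ->]]]; apply: commuteM.
  by apply: C12 => //; rewrite Q1E.
by apply/commute_sym; apply: RP => //; exact: Q2P.
Qed.

(** N is the direct product of its intersections with gAg^-1 and gC(A)g^-1. One of them is trivial,
    and [fac_disjoint] then puts N inside the other factor. *)
Lemma indec_uncut N g : fac N -> indec N -> N `<=` cj g V ->
  N `<=` cj g A \/ N `<=` cj g ('C A).
Proof.
move=> fN iN Ng; have fB := fac_cj g fA; have [sN _ _ _ _] := fN.
have [_ _ _ BE _] := fB.
have : dprod (N `&` cj g A) (N `&` 'C (cj g A)) N.
  split; [exact/subI/sub_fac | apply: subI => //; exact: sub_centr | |].
    by move=> x [_ Cx] y [_ By]; exact: Cx.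
  apply/seteqP; split; last by apply: mulset_sub => // x [].
  move=> x Nx; apply: (fac_split hausG QZG centr_compact fN fB); split=> //.
  by have := Ng _ Nx; rewrite cj_mulset centr_cj.
move=> /iN[E|E].
  right; rewrite -centr_cj; apply: (fac_disjoint hausG QZG centr_compact fN fB).
  by rewrite E.
left; rewrite -BE; apply: (fac_disjoint hausG QZG centr_compact fN (fac_centr fB)).
by rewrite E.
Qed.

(** If N meets gAg^-1 trivially it already lies in gC(A)g^-1; otherwise it is replaced by that
    intersection. *)
Lemma exists_fac_list (s : seq G) : exists N, fac N /\ forall g, g \in s -> N `<=` cj g V.
Proof.
elim: s => [|g s [N [fN sN]]]; first by exists A.
have fB := fac_cj g fA.
have VE : cj g V = mulset (cj g A) ('C (cj g A)) by rewrite cj_mulset centr_cj.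
have [E|NB] := pselect (N `&` cj g A = [set 1]).
  exists N; split=> // h; rewrite in_cons => /orP[/eqP->|]; last exact: sN.
  rewrite VE; apply: subset_trans (centr_sub_m fB).
  by apply: (fac_disjoint hausG QZG centr_compact fN fB); rewrite E.
exists (N `&` cj g A); split; first exact: fac_meet.
move=> h; rewrite in_cons => /orP[/eqP->|hs].
  by rewrite VE; apply: subset_trans (fac_sub_m fB) => x [].
by apply: subset_trans (sN h hs) => x [].
Qed.

Lemma exists_indec_compact X : compact X ->
  exists N, [/\ fac N, indec N & forall g, X g -> N `<=` cj g V].
Proof.
move=> cX; have [sV oV _] := cV; have [n [s [_ sP]]] := compact_cov sV oV cX.
have [N [fN sN]] := exists_fac_list s; have [P [fP iP PN]] := exists_indec fN.
exists P; split=> // g /sP[f fs Vf].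
by rewrite -(mulVKg f g) cjM (cj_id sV Vf); apply: subset_trans PN _; exact: sN.
Qed.

(** Otherwise f maps the ball of radius m+1 into that of radius m. Writing xy as (fx^-1)^-1(fy), the
    ball of radius 2m+2 lies in that of radius 2m, which is then all of G, and G would be
    compact. *)
Lemma pw_unbounded m f : exists x, pw S m.+1 x /\ ~ pw S m (f * x).
Proof.
apply: contrapT => /forallNP no.
have fx x : pw S m.+1 x -> pw S m (f * x).
  by move=> mx; apply: contrapT => nx; exact: (no x).
have step z : pw S (m.+1 + m.+1) z -> pw S (m + m) z.
  move=> /pw_split[x [y [/(pwV SV)/fx mx /fx my ->]]].
  have -> : x * y = (f * x^-1)^-1 * (f * y) by rewrite invgM invgK mulgA mulgVK.
  by apply: pw_add => //; exact: pwV.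
have step1 z : pw S (m + m).+1 z -> pw S (m + m) z.
  by move=> mz; apply: step; apply: pw_leq mz => //; rewrite addSn addnS.
have all n z : pw S (n + (m + m)) z -> pw S (m + m) z.
  elim: n z => // n IH z; rewrite addSn -addn1 addnC => /pw_split[x [y [x1 /IH my ->]]].
  by apply: step1; exact: pw_add x1 my.
apply: (not_bddT nontrivG no_compact_normal); exists (pw S (m + m)); first exact: pw_compact.
move=> z _; have [n nz] := pw_all SV KS genK z.
by apply: (all n); apply: pw_leq nz => //; exact: leq_addr.
Qed.

(* Translates rho of small indecomposable factors, moved so that V contains rho while a
   neighbouring conjugate of V does not; j ranges over their elements. *)
Definition escaping n j := exists N t,
  [/\ fac N, indec N, V j /\ N j, S t /\ ~ cj t V j &
      forall k, k <= n -> exists2 z, pw S k z & forall x, pw S k x -> N `<=` cj (z^-1 * x) V].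

Hypothesis bE : forall N, fac N -> bdd [set g | N `<=` cj g V].

Lemma exists_escaping n : escaping n !=set0.
Proof.
have [N [fN iN Nn]] := exists_indec_compact (@pw_compact _ _ n cS).
have [m mP] : exists m, `[< exists x, pw S m x /\ ~ (N `<=` cj x V) >].
  have [g Ng] : exists g, ~ (N `<=` cj g V).
    apply/existsNP => Nall; apply: (not_bddT nontrivG no_compact_normal).
    by apply: bddS (bE fN) => g _; exact: Nall.
  by have [m mg] := pw_all SV KS genK g; exists m; apply/asboolP; exists g.
(* The least length of a word x such that xVx^-1 fails to contain N; it exceeds n by the choice of
   N. Below, x = yt with t its last letter, and everything is conjugated by y^-1. *)
have ex : exists m, `[< exists x, pw S m x /\ ~ (N `<=` cj x V) >] by exists m.
case: (ex_minnP ex) => {mP}m /asboolP[x [mx nNx]] mmin.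
have Nm k y : k < m -> pw S k y -> N `<=` cj y V.
  move=> km ky; apply: contrapT => nNy; move: km; rewrite ltnNge mmin //.
  by apply/asboolP; exists y.
have nm : n < m.
  by rewrite ltnNge; apply/negP => mn; apply: nNx; apply: Nn; exact: pw_leq mn _ mx.
case: m => // m in mx mmin Nm nm *.
move: mx; rewrite -addn1 => /pw_split[y [t [my /pw_1 St xE]]].
have [h [Nh nVh]] : exists h, N h /\ ~ cj x V h.
  by move/existsNP: nNx => [h /not_implyP]; exists h.
have Ny : N `<=` cj y V by exact: Nm my.
exists (h ^ y), (cj y^-1 N), t; split.
- exact: fac_cj.
- exact: indec_cj.
- by split; [exact: Ny | rewrite /cj /= conjgK].
- by split=> //; rewrite /cj /= -conjgM -xE.
move=> k kn; have km : k <= m by exact: leq_trans kn _.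
(* z is the tail of length k of y = wz, so yz^-1u = wu still has length below the minimum. *)
move: my; rewrite -(subnK km) => /pw_split[w [z [wm zk yE]]].
exists z => // u uk; rewrite cjSl invgK -cjM yE mulgA mulgK.
by apply: (Nm m) => //; rewrite -(subnK km); exact: pw_add.
Qed.

Lemma escaping_leq m n : m <= n -> escaping n `<=` escaping m.
Proof.
move=> mn j [N [t [fN iN VN St kP]]]; exists N, t; split=> // k km.
by apply: kP; exact: leq_trans mn.
Qed.

(** The sets [escaping n] decrease inside the compact V. Near 1 all elements lie in every tVt^-1
    with t in S, as these are finitely many conjugates, whereas an escaping element avoids one of
    them; so j is not 1. *)
Lemma exists_cluster : exists2 j, j <> 1 & forall n, closure (escaping n) j.
Proof.
have [sV oV cV'] := cV.
pose F : set_system G := [set X | exists n, escaping n `<=` X].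
have FF : ProperFilter F.
  split; first by move=> [n nF]; have [j /nF] := exists_escaping n.
  split; first by exists 0%N.
    move=> P Q [n nP] [m mQ]; exists (maxn n m) => j ej; split.
      by apply: nP; apply: escaping_leq ej; exact: leq_maxl.
    by apply: mQ; apply: escaping_leq ej; exact: leq_maxr.
  by move=> P Q PQ [n nP]; exists n; exact: subset_trans PQ.
have FV : F V by exists 0%N => j [N [t [_ _ []]]].
have [j [Vj clj]] := cV' F FF FV.
have jn n : closure (escaping n) j by move=> W Wj; apply: clj Wj; exists n.
exists j => // j1.
have [n [s [_ sP]]] := compact_cov sV oV cS.
have nj : nbhs j (cap_cj s V).
  apply: open_nbhs_nbhs; split; first exact: open_cap_cj.
  by rewrite j1; exact: (sub1 (sub_cap_cj s sV)).
have [i [[N [t [_ _ _ [St nVi] _]]] si]] := jn 0%N _ nj.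
have [f fs Vf] := sP t St; apply: nVi.
by rewrite -(mulVKg f t) cjM (cj_id sV Vf); exact: si.
Qed.

(* Each escaping element lies in a factor that is contained in gVg^-1 for g in a large
   translated ball, hence in gAg^-1 or gC(A)g^-1 for some g for which gAg^-1 cuts B. *)
Lemma cluster_centralises j B : (forall n, closure (escaping n) j) -> fac B ->
  exists N, [/\ fac N, N `<=` B & 'C N j].
Proof.
move=> jn fB; have [sV oV cV'] := cV.
have [m mP] := bdd_pw S1 SV KS genK sV oV VS (bE fB).
(* The element fu(f) lies outside the ball of radius m, which contains every g with B inside gVg^-1;
   so its conjugate of V cuts B. *)
have /choice[u uP] f : exists x, pw S m.+1 x /\ ~ (B `<=` cj (f * x) V).
  have [x [mx nx]] := pw_unbounded m f; exists x; split=> // Bx; apply: nx.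
  exact: mP.
have [n cn] := compact_cov sV oV (@pw_compact _ _ m.+2 cS).
have [s [_ _ sP]] := cov_inv sV cn.
pose Z f := 'C (B `&` cj (f * u f) ('C A)) `|` 'C (B `&` cj (f * u f) A).
have cZ : closed (\bigcup_(f in [set` s]) Z f).
  apply: closed_bigcup; first exact: finite_seq.
  by move=> f _; apply: closedU; exact: closed_centr.
have eZ : escaping m.+2 `<=` \bigcup_(f in [set` s]) Z f.
  move=> i [N [t [fN iN [_ Ni] _ kP]]].
  have [z mz zP] := kP m.+2 (leqnn _).
  have [f fs Vf] := sP _ (pwV SV mz); exists f => //.
  have : N `<=` cj (f * u f) V.
    (* Here f represents the coset of z^-1, so the correction is one letter from V and u(f) takes
       m+1 more: hence the radius m+2. *)
    have -> : f * u f = z^-1 * ((f^-1 * z^-1)^-1 * u f).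
      by rewrite invgM !invgK !mulgA mulVg mul1g.
    apply: zP; rewrite -[m.+2]add1n; apply: pw_add; last by have [] := uP f.
    by apply/pw_S/VS; exact: subV.
  move=> /(indec_uncut fN iN)[NA|NA]; [left|right] => x [_ Ax].
    by move: Ax; rewrite -centr_cj => /(_ _ (NA _ Ni))/commute_sym.
  by have := NA _ Ni; rewrite -centr_cj => /(_ _ Ax).
have [f _ Zj] : (\bigcup_(f in [set` s]) Z f) j.
  by apply: cZ; apply: closure_subset (jn m.+2).
have [_ nB] := uP f; have fg := fac_cj (f * u f) fA.
have VE : cj (f * u f) V = mulset (cj (f * u f) A) ('C (cj (f * u f) A)).
  by rewrite cj_mulset centr_cj.
have [_ _ _ BE _] := fg.
case: Zj; rewrite -?centr_cj => Cj.
  exists (B `&` 'C (cj (f * u f) A)); split=> //.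
  apply: (fac_meet hausG QZG centr_compact fB (fac_centr fg)) => E; apply: nB; rewrite VE.
  apply: subset_trans (fac_sub_m fg); rewrite -[X in _ `<=` X]BE.
  by apply: (fac_disjoint hausG QZG centr_compact fB (fac_centr fg)); rewrite E.
exists (B `&` cj (f * u f) A); split=> //.
apply: (fac_meet hausG QZG centr_compact fB fg) => E; apply: nB; rewrite VE.
apply: subset_trans (centr_sub_m fg).
by apply: (fac_disjoint hausG QZG centr_compact fB fg); rewrite E.
Qed.

(** If jBj^-1 is not inside B, it meets C(B) in a factor, which contains a factor N centralised by
    j. Then N = j^-1Nj lies in B and in C(B), which is absurd. The other inclusion is symmetric. *)
Lemma cluster_normalises j B : (forall n, closure (escaping n) j) -> fac B -> cj j B = B.
Proof.
move=> jn fB; have fjB := fac_cj j fB.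
have fixN N x : 'C N j -> N x -> x ^ j = x.
  by move=> Cj Nx; rewrite conjgE -(Cj x Nx) mulKg.
have not1 N D : fac N -> fac D -> N `<=` D -> N `<=` 'C D -> False.
  move=> [sN N1 _ _ _] fD ND NC; apply: N1; apply: set1_sub => // x Nx.
  by apply: (fac_capC QZG fD); split; [exact: ND | exact: NC].
apply/seteqP; split; apply: contrapT => nsub.
  have fM : fac (cj j B `&` 'C B).
    apply: (fac_meet hausG QZG centr_compact fjB (fac_centr fB)) => E; apply: nsub.
    have [_ _ _ BE _] := fB; rewrite -[X in _ `<=` X]BE.
    by apply: (fac_disjoint hausG QZG centr_compact fjB (fac_centr fB)); rewrite E.
  have [N [fN NM Cj]] := cluster_centralises jn fM.
  apply: (not1 N B fN fB) => x Nx; have [jBx CBx] := NM x Nx => //.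
  by rewrite -(fixN N x Cj Nx).
have fM : fac (B `&` 'C (cj j B)).
  apply: (fac_meet hausG QZG centr_compact fB (fac_centr fjB)) => E; apply: nsub.
  have [_ _ _ BE _] := fjB; rewrite -[X in _ `<=` X]BE.
  by apply: (fac_disjoint hausG QZG centr_compact fB (fac_centr fjB)); rewrite E.
have [N [fN NM Cj]] := cluster_centralises jn fM.
apply: (not1 N (cj j B) fN fjB) => x Nx; have [Bx CBx] := NM x Nx => //.
by rewrite /cj /= (fixN N x Cj Nx).
Qed.

(** Normalising every gAg^-1, j also normalises every gVg^-1. So j lies in all conjugates of the
    normaliser of V, which is compact and open. *)
Lemma not_all_bdd : False.
Proof.
have [j j1 jn] := exists_cluster; apply: j1.
apply: (conj_core1 no_compact_normal (compact_normaliser no_inf_quot cV)) => g.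
rewrite normaliserE /cj /= -/(cj _ V) conjgE cjM cjM.
have gA := cluster_normalises jn (fac_cj g fA).
have -> : cj j (cj g V) = cj g V.
  by rewrite cj_mulset cj_mulset -(centr_cj g) -(centr_cj j) gA.
by rewrite cjVK.
Qed.

End Dynamics.

(** * Ends of graphs *)

Section Ends.
Variable T : simple_graph.
Implicit Types (D F X : set T) (x y z : T).

Lemma joined_refl X x : X x -> joined_in X x x.
Proof. by move=> Xx; exists [::]; split=> //=; rewrite andbT; apply: mem_set. Qed.

Lemma joined_cons X x z y : X x -> adj x z -> joined_in X z y -> joined_in X x y.
Proof.
move=> Xx xz [p [zp py pX]]; exists (z :: p); split=> //=; first by rewrite xz.
by apply/andP; split; [exact: mem_set | exact: pX].
Qed.

Lemma joined_ind X y (P : T -> Prop) : (X y -> P y) ->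
  (forall x z, X x -> adj x z -> joined_in X z y -> P z -> P x) ->
  forall x, joined_in X x y -> P x.
Proof.
move=> Py IH x [p]; elim: p x => [|z p IHp] x [/= xp py pX].
  by rewrite py in pX *; apply: Py; move: pX; rewrite andbT => /set_mem.
move: xp pX => /andP[xz zp] /andP[Xx pX].
by apply: (IH x z) => //; [exact: set_mem Xx | exists p | exact: IHp].
Qed.

Lemma joined_inl X x y : joined_in X x y -> X x.
Proof. by apply: (@joined_ind X y X). Qed.

Lemma joined_trans X x y z : joined_in X x y -> joined_in X y z -> joined_in X x z.
Proof.
move=> + yz; apply: (@joined_ind X y (fun x => joined_in X x z)) => // u v Xu uv _.
exact: joined_cons.
Qed.

Lemma joined_sym X x y : joined_in X x y -> joined_in X y x.
Proof.
apply: (@joined_ind X y (fun x => joined_in X y x)); first exact: joined_refl.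
move=> u v Xu uv vy yv; apply: (joined_trans yv).
apply: (@joined_cons _ _ u); [exact: joined_inl vy | by rewrite adj_sym | exact: joined_refl].
Qed.

(** The cases describe the last visit of the path to d: it ends there, never goes there, or leaves
    through a neighbour z for good. *)
Lemma joined_avoid D d x y : joined_in (~` D) x y ->
  [\/ y = d, joined_in (~` (d |` D)) x y |
      exists2 z, adj d z & joined_in (~` (d |` D)) z y].
Proof.
move: x; apply: joined_ind.
  move=> nDy; have [->|yd] := pselect (y = d); first by apply: Or31.
  by apply: Or32; apply: joined_refl; case.
move=> x z nDx xz _ [->|zy|H]; [exact: Or31 | | exact: Or33].
have [xd|xd] := pselect (x = d); first by apply: Or33; exists z => //; rewrite -xd.
by apply: Or32; apply: joined_cons xz zy; case.
Qed.

Hypothesis conT : connected_graph T.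
Hypothesis lfT : locally_finite T.

Definition reaches F D x := infinite_set [set y | F y /\ joined_in (~` D) x y].

Lemma reaches_avoid F D d x : reaches F D x ->
  reaches F (d |` D) x \/ exists2 z, adj d z & reaches F (d |` D) z.
Proof.
move=> rx; apply: contrapT => /not_orP[/contrapT fx /forall2NP nz]; apply: rx.
pose Y z := [set y | F y /\ joined_in (~` (d |` D)) z y].
apply: (@sub_finite_set _ _ ([set d] `|` (Y x `|` \bigcup_(z in [set z | adj d z]) Y z))).
  move=> y [Fy /(joined_avoid d)[->|xy|[z dz zy]]]; [by left| by right; left |].
  by right; right; exists z.
rewrite finite_setU; split; first exact: finite_set1.
rewrite finite_setU; split; first exact: fx.
apply: bigcup_finite; first exact: lfT.
by move=> z dz; have [//|/contrapT] := nz z.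
Qed.

Lemma reaches_out F D x : reaches F D x -> ~ D x.
Proof. by move=> /infinite_setN0[y [_ /joined_inl]]. Qed.

Lemma exists_reaches F D : infinite_set F -> finite_set D -> exists x, reaches F D x.
Proof.
move=> iF /finite_setP[n]; elim: n D => [D|n IH D].
  rewrite II0 card_eq0 => /eqP ->; have [[x _] con] := conT; exists x => fin; apply: iF.
  apply: sub_finite_set fin => y Fy; split=> //; rewrite setC0; exact: con.
move=> /eq_cardSP[d Dd /IH[x /(reaches_avoid d)]].
by rewrite setD1K //; case=> [rx|[z _ rz]]; [exists x | exists z].
Qed.

(** König's argument: delete the current vertex and step to a neighbour from which infinitely many
    vertices of F can still be reached. Deletion makes the ray injective. *)
Lemma exists_ray F D : infinite_set F -> finite_set D -> exists r,
  ray r /\ forall n, exists2 y, F y & joined_in (~` D) (r n) y.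
Proof.
move=> iF fD; have [x0 r0] := exists_reaches iF fD.
have /choice[f fP] (p : T * set T) : exists z, reaches F p.2 p.1 ->
    adj p.1 z /\ reaches F (p.1 |` p.2) z.
  have [rp|nr] := pselect (reaches F p.2 p.1); last by exists p.1.
  have [/reaches_out[]|[z pz rz]] := reaches_avoid p.1 rp; first by left.
  by exists z.
pose q n := iter n (fun p : T * set T => (f p, p.1 |` p.2)) (x0, D).
have rq n : reaches F (q n).2 (q n).1 by elim: n => //= n /fP[].
have subq n m : n <= m -> (q n).2 `<=` (q m).2.
  move=> /subnKC <-; elim: (m - n) => [|k IH]; first by rewrite addn0.
  by rewrite addnS => x /IH qx; right.
have inq n m : n < m -> (q m).2 (q n).1 by move=> /subq; apply; left.
exists (fun n => (q n).1); split.
  split; last by move=> n; have [] := fP _ (rq n).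
  move=> n m /= E; have [/inq|/inq|//] := ltngtP n m.
    by rewrite E => /(reaches_out (rq m)).
  by rewrite -E => /(reaches_out (rq n)).
move=> n; have /infinite_setN0[y [Fy qy]] := rq n; exists y => //.
have := @subq 0%N n (leq0n n); move: qy => [p [pp py pq]] Dq; exists p; split=> //.
by apply: sub_all pq => u /set_mem nqu; apply: mem_set => /Dq.
Qed.

Definition boundary F := [set x | F x /\ exists2 y, adj x y & ~ F y].

Lemma joined_boundary F x y : joined_in (~` boundary F) x y -> F x <-> F y.
Proof.
move: x; apply: joined_ind => // x z nBx xz zy <-; split=> Fx; apply: contrapT => nF.
  by apply: nBx; split=> //; exists z.
by apply: (joined_inl zy); split=> //; exists x => //; rewrite adj_sym.
Qed.

Lemma exists_ray_in F : infinite_set F -> finite_set (boundary F) ->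
  exists r, ray r /\ forall n, F (r n).
Proof.
move=> iF fB; have [r [rr rF]] := exists_ray iF fB; exists r; split=> // n.
by have [y Fy ry] := rF n; apply/(joined_boundary ry).
Qed.

Lemma ray_equiv_refl (r : nat -> T) : ray r -> ray_equiv r r.
Proof.
move=> [rinj radj] X fX.
have [n nP] : exists n, forall i, n <= i -> ~ X (r i).
  have fr : finite_set (r @^-1` X) by apply: finite_preimage fX => i j _ _; exact: rinj.
  have /finite_seqP[s sE] := fr.
  exists (\max_(i <- s) i).+1 => i; rewrite ltnNge => /negP ni Xi; apply: ni.
  have si : i \in s by have : (r @^-1` X) i by []; rewrite sE.
  by rewrite (big_rem i) //= leq_maxl.
have up i k : n <= i -> joined_in (~` X) (r i) (r (i + k)).
  elim: k i => [|k IH] i ni; first by rewrite addn0; apply: joined_refl; exact: nP.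
  apply: joined_cons (radj i) _; first exact: nP.
  by rewrite -addSnnS; apply: IH; exact: leqW.
exists n => i j ni nj; have [ij|/ltnW ji] := leqP i j.
  by rewrite -(subnKC ij); exact: up.
by apply: joined_sym; rewrite -(subnKC ji); exact: up.
Qed.

(** If F and its complement are both infinite, each contains a ray. With a single end these rays are
    joined off the finite boundary of F, which no path avoiding it can cross. *)
Lemma one_end_boundary F : ends T #= `I_1 -> finite_set (boundary F) ->
  finite_set F \/ finite_set (~` F).
Proof.
move=> /eq_cardSP[c _]; rewrite II0 card_eq0 => /eqP cE fB.
apply: contrapT => /not_orP[iF iF'].
have fB' : finite_set (boundary (~` F)).
  apply: (@sub_finite_set _ _ (\bigcup_(x in boundary F) [set y | adj x y])).
    move=> y [nFy [x yx /contrapT Fx]]; exists x; last by rewrite /= adj_sym.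
    by split=> //; exists y => //; rewrite adj_sym.
  by apply: bigcup_finite => // x _; exact: lfT.
have [r [rr rF]] := exists_ray_in iF fB; have [q [rq qF]] := exists_ray_in iF' fB'.
have endc p : ray p -> [set p' | ray p' /\ ray_equiv p p'] = c.
  move=> rp; apply: contrapT => nc.
  have : (ends T `\ c) [set p' | ray p' /\ ray_equiv p p'] by split=> //; exists p.
  by rewrite cE.
have : [set p' | ray p' /\ ray_equiv q p'] q by split=> //; exact: ray_equiv_refl.
rewrite (endc q rq) -(endc r rr) => -[_ /(_ _ fB)[n /(_ n n (leqnn n) (leqnn n))]].
by move=> rqn; apply: (qF n); apply/(joined_boundary rqn).
Qed.

End Ends.

(** * Almost invariant subsets of a one-ended group *)

Section OneEnded.
Variable G : topologicalGroupType.
Implicit Types (E V : set G) (g h s : G).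

(** Stabilisers being compact and open, relatively compact sets correspond to finite vertex sets.
    The orbit map sends E to a set F of vertices; an edge leaving F joins gv to gsv for one of
    finitely many s, so its boundary is finite. *)
Lemma one_ended_dichotomy V E : one_ended G -> cosub V ->
  (forall g u, V u -> E g -> E (g * u)) ->
  (forall s, bdd [set g | E g /\ ~ E (g * s)]) -> bdd E \/ bdd (~` E).
Proof.
move=> [T [a [[conT lfT a1 aM aadj atr ast] ends1]]] cV EV bE.
have [[v _] _] := conT; have [oW cW] := ast v.
set W := [set g | a g v = v] in oW cW.
have aV g x y : a g x = y -> a g^-1 y = x by move=> <-; rewrite -aM mulVg a1.
have sW : subgroup W.
  by apply: mksub => [|g h gW hW]; rewrite /W /= ?a1 // aM hW; exact: aV.
have [sV oV cV'] := cV.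
pose F : set T := [set x | exists2 g, E g & a g v = x].
pose L s := [set g | E g /\ ~ E (g * s)].
have finL X : bdd X -> finite_set [set x | exists2 g, X g & a g v = x].
  move=> bX; have [n [s [_ sP]]] := cov_bdd sW oW bX.
  apply: (@sub_finite_set _ _ ((fun f => a f v) @` [set` s]));
    last exact/finite_image/finite_seq.
  move=> _ [g /sP[f fs Wf] <-]; exists f => //.
  have Wf' : a (f^-1 * g) v = v := Wf.
  by rewrite -[in RHS](mulVKg f g) aM Wf'.
have bddL (X : set T) : finite_set X -> bdd [set g | X (a g v)].
  move=> fX; have [f fP] := choice (fun x => atr v x).
  have : bdd (\bigcup_(g in f @` X) mulset [set g] W).
    apply: bdd_bigcup; first exact: finite_image.
    by move=> g _; apply: bddM; [exact: bdd_set1 | exists W].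
  apply: bddS => g Xg; exists (f (a g v)); first by exists (a g v).
  exists (f (a g v)), ((f (a g v))^-1 * g); rewrite mulVKg; split=> //.
  by rewrite /W /= aM; exact: aV.
have [h hP] := choice (fun x => atr v x).
have fB : finite_set (boundary F).
  have : bdd (\bigcup_(s in h @` [set y | adj v y]) L s).
    by apply: bdd_bigcup => [|s _]; [apply: finite_image; exact: lfT | exact: bE].
  move=> /finL; apply: sub_finite_set => x [[g Eg gx] [y xy nFy]].
  exists g => //; exists (h (a g^-1 y)).
    exists (a g^-1 y) => //=; rewrite -(aadj g) -aM mulgV a1 gx; exact: xy.
  split=> // Egh; apply: nFy; exists (g * h (a g^-1 y)) => //.
  by rewrite aM hP -aM mulgV a1.
have [fF|fF] := one_end_boundary conT lfT ends1 fB.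
  by left; apply: bddS (bddL _ fF) => g Eg; exists g.
(* If gv lies in F but g is not in E, then g = kw with k in E and w in W. For w in fV, invariance
   under V shows that kf is not in E, which confines k to a relatively compact set. *)
right; have [n [s [_ sP]]] := compact_cov sV oV cW.
have : bdd ([set g | (~` F) (a g v)] `|` mulset (\bigcup_(f in [set` s]) L f) W).
  apply: bddU; first exact: bddL.
  by apply: bddM; [apply: bdd_bigcup => [|f _]; [exact: finite_seq | exact: bE] | exists W].
apply: bddS => g nEg; have [[k Ek kg]|nF] := pselect (F (a g v)); [right | by left].
have Wkg : W (k^-1 * g) by rewrite /W /= aM; exact: aV.
exists k, (k^-1 * g); rewrite mulVKg; split=> //.
have [f fs Vf] := sP _ Wkg; exists f => //; split=> // Ekf; apply: nEg.
by have := EV _ _ Vf Ekf; rewrite -mulgA mulVKg mulVKg.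
Qed.

End OneEnded.

(** * Deduction of local indecomposability *)

Theorem corollary4p9 (G : topologicalGroupType)
  (nontrivG : [set: G] <> [set 1])
  (tdlcG : tdlc G)
  (cgG : compactly_generated G)
  (oneG : one_ended G)
  (QZG : quasicentre G = [set 1])
  (no_compact_normal : forall K : set G,
     normal_subgroup setT K -> compact K -> K = [set 1])
  (lfqtG : locally_finite_quotient_type G)
  (no_inf_quot : forall O : set G,
     subgroup O -> open O -> ~ has_infinite_discrete_quotient O)
  (centr_compact : forall H : set G,
     locally_normal H -> closed H -> H <> [set 1] -> compact (centraliser H)) :
  locally_indecomposable G.
Proof.
move=> H [sH cH [O [L [sO oO [sH' sL HL [bijO _ _]]]]]].
apply: contrapT => /not_orP[nd no]; have [hausG _ _] := tdlcG.
have OE : O = mulset H L.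
  have [im _ surj] := bijO; apply/seteqP; split=> [x /surj|_ [h [l [Hh Ll ->]]]].
    by move=> [[h l] [/= Hh Ll] <-]; exact: mulsetI.
  by have := im (h, l); apply.
have H1 : H <> [set 1].
  move=> HE; apply: nd => x; rewrite HE => ->; split; first exact: mem_set.
  by exists setT; [exact: filterT | rewrite setTI].
have L1 : L <> [set 1].
  move=> LE; apply: no; suff <- : O = H by [].
  rewrite OE LE; apply/seteqP; split=> [_ [h [_ [Hh -> ->]]]|h Hh]; first by rewrite mulg1.
  by exists h, 1; rewrite mulg1.
have HC : H `<=` 'C L by move=> h Hh l Ll; exact: HL.
have nontriv X Y : subgroup X -> X <> [set 1] -> X `<=` Y -> Y <> [set 1].
  by move=> sX X1 XY YE; apply: X1; apply: set1_sub => //; rewrite -YE.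
(* C(L) contains H and its centraliser contains L, so both are nontrivial and their product contains
   the open subgroup O = HL. *)
have fA : fac ('C L).
  split; [exact: sub_centr | exact: nontriv HC | | exact: centr3 |].
    by apply: nontriv sL L1 _; exact: sub_centr2.
  apply: (open_sub _ oO (sub1 sO)); first by apply: sub_mulset; [exact: sub_centr.. |].
  by rewrite OE; apply: mulsetS => //; exact: sub_centr2.
have [K cK genK] := cgG.
have cV := cosub_mfac hausG centr_compact fA; set V := mulset _ _ in cV.
apply: (not_all_bdd hausG nontrivG QZG no_compact_normal lfqtG no_inf_quot
  centr_compact cK genK fA) => N fN.
have [//|bN] : bdd [set g | N `<=` cj g V] \/ bdd (~` [set g | N `<=` cj g V]).
  apply: (one_ended_dichotomy oneG cV).
    by move=> g u Vu; have [sV _ _] := cV; rewrite /= cjM (cj_id sV Vu).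
  move=> s; exact: (almost_invariant hausG QZG no_compact_normal lfqtG no_inf_quot
    centr_compact cK genK fA s fN).
by exfalso; apply: (not_cobdd hausG QZG no_compact_normal centr_compact fA fN bN).
Qed.
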